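(* Let $\Gamma$ be any 2-agent zero-sum game in which all entries of $A=A^{(12)}$ are distinct, and let $\bar X^T=\frac1T\sum_{t=1}^T X^t$ where $X^t$ is generated by Stochastic MWU. There exists $\eta_0>0$ such that for all learning rates $\eta<\eta_0$: (1) the sequence $\{\bar X^t\}_{t=1}^\infty$ has a convergent subsequence; (2) every convergent subsequence of $\{\bar X^t\}_{t=1}^\infty$ converges to a mixture of pure strategies, i.e., to a probability distribution supported on pure strategy profiles.
   Context: Two agents with finite pure strategy sets $\mathcal{S}_1,\mathcal{S}_2$ and simplices $\mathcal{X}_i$ of mixed strategies, $\mathcal{X}=\mathcal{X}_1\times\mathcal{X}_2$; $A^{(12)}=A$, $A^{(21)}=-A^\top$, agent $i$'s expected payoff is $\langle x_i,A^{(ij)}x_j\rangle$. Stochastic MWU with learning rate $\eta$ (used by both agents): given $X^t$, each agent $j$ independently samples a pure strategy $s_j$ with probability $X^t_{js_j}$, and then $X^{t+1}_{i\hat s}=\dfrac{X^t_{i\hat s}\exp(\eta\langle e_{\hat s},A^{(ij)}e_{s_j}\rangle)}{\sum_{\bar s\in\mathcal{S}_i}X^t_{i\bar s}\exp(\eta\langle e_{\bar s},A^{(ij)}e_{s_j}\rangle)}$ for $i\ne j$ (with $0/0=0$). Here $X^t$ is a random element of $\mathcal{X}$ and $\bar X^T$ is understood as the time-average of the laws (distributions on $\mathcal{X}$) of $X^1,\dots,X^T$, with convergence meaning weak convergence of probability measures on $\mathcal{X}$. *)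

(* Defs.v *)
From HB Require Import structures.
From mathcomp Require Import all_boot all_order all_algebra.
From mathcomp Require Import all_classical all_reals all_analysis.
Set Implicit Arguments. Unset Strict Implicit. Unset Printing Implicit Defensive.
Import Order.TTheory GRing.Theory Num.Theory.
Import numFieldNormedType.Exports.
Local Open Scope classical_set_scope.
Local Open Scope ring_scope.

Section Game.
Variables (R : realType) (n1 n2 : nat).

Definition profile := ('rV[R]_n1 * 'rV[R]_n2)%type.

Definition borelT := g_sigma_algebraType (@open profile).

Definition in_simplex (m : nat) (x : 'rV[R]_m) : Prop :=
  (forall i, 0 <= x ord0 i) /\ \sum_(i < m) x ord0 i = 1.

Definition mixedX : set profile :=
  [set x | in_simplex x.1 /\ in_simplex x.2].

Definition pure_profiles : set profile :=
  [set x | exists (s1 : 'I_n1) (s2 : 'I_n2),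
      x = (delta_mx ord0 s1, delta_mx ord0 s2)].

Variables (A : 'M[R]_(n1, n2)) (eta : R).

(* One step of stochastic MWU given sampled pure strategies s1, s2.
   Agent 1 uses A^(12) = A against s2; agent 2 uses A^(21) = -A^T against s1.
   Division by 0 is 0 in MathComp (matches the 0/0 = 0 convention). *)
Definition mwu_step (x : profile) (s1 : 'I_n1) (s2 : 'I_n2) : profile :=
  (\row_(i < n1) (x.1 ord0 i * expR (eta * A i s2) /
       \sum_(k < n1) x.1 ord0 k * expR (eta * A k s2)),
   \row_(j < n2) (x.2 ord0 j * expR (eta * (- A s1 j)) /
       \sum_(k < n2) x.2 ord0 k * expR (eta * (- A s1 k)))).

(* expect t f x = E[ f(X^{t+1}) ] when X^1 = x (deterministic start):
   first-step decomposition of the Markov chain, with (s1, s2) drawn with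
   probability x_{1 s1} * x_{2 s2} (independent sampling). *)
Fixpoint expect (t : nat) (f : profile -> R) (x : profile) : R :=
  match t with
  | 0 => f x
  | t'.+1 => \sum_(s1 < n1) \sum_(s2 < n2)
               x.1 ord0 s1 * x.2 ord0 s2 * expect t' f (mwu_step x s1 s2)
  end.

(* Integral of f against the time-averaged law \bar X^T = (1/T) sum_{t=1}^T law(X^t). *)
Definition avg_expect (T : nat) (f : profile -> R) (x0 : profile) : R :=
  (T%:R)^-1 * \sum_(t < T) expect t f x0.

(* Weak convergence of the subsequence k |-> \bar X^{phi k + 1} to the Borel
   probability measure mu on X: the integrals of every continuous bounded
   function on X converge (continuous functions on the compact X are bounded). *)
Definition weak_conv_sub (x0 : profile) (phi : nat -> nat)
    (mu : {measure set borelT -> \bar R}) : Prop :=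
  forall f : profile -> R, {within mixedX, continuous f} ->
    (fun k => avg_expect (phi k).+1 f x0) @ \oo
      --> Rintegral mu (mixedX : set borelT) f.

Definition prob_on_X (mu : {measure set borelT -> \bar R}) : Prop :=
  mu (mixedX : set borelT) = 1%E /\ mu setT = 1%E.

End Game.

Definition subsequence (phi : nat -> nat) : Prop :=
  forall m n : nat, (m < n)%N -> (phi m < phi n)%N.

(* Main.v *)
(** The time averages of the total spread [total_spread x], which vanishes
    exactly at pure profiles, tend to 0 uniformly on every face of [mixedX], by
    induction on the face. On a given face, let [(p, q)] be an equilibrium of the
    game with matrix [- A]. The weighted sum
    [sum_i p_i * ln x_i + sum_j q_j * ln y_j] then has nonpositive first-order
    drift, and the Jensen gaps of the two log-partition functions make the drift
    strictly negative off the pure profiles, because the entries of [A] are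
    distinct. A small power of the corresponding product is therefore a bounded
    supermartingale, so the chain spends most of its time near the pure profiles
    and the faces on which this product vanishes. Those are smaller, and
    compactness with the Feller property transfers the induction hypothesis to
    their neighbourhood.

    Consequently a continuous function vanishing at the pure profiles has time
    averages tending to 0, and up to such a function every continuous [f] is
    [sum_s f (pure_profile s) * pure_prob s]. Subsequential limits are thus finite
    mixtures of Dirac masses, obtained by Bolzano-Weierstrass from the finitely
    many weights, and any weak limit integrates [total_spread] to 0. *)
Require Import Defs.
From HB Require Import structures.
From mathcomp Require Import all_boot all_order all_algebra.
From mathcomp Require Import all_classical all_reals all_analysis.
From mathcomp Require Import measurable_realfun ring lra.
Import Order.TTheory GRing.Theory Num.Theory.
Import numFieldNormedType.Exports.
Local Open Scope classical_set_scope.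
Local Open Scope ring_scope.

(** * Means and variances of finite distributions *)

(** The square of the tangent bound [1 + c / 2 <= expR (c / 2)]; the condition on [c] keeps the left
    side nonnegative, so that squaring is monotone. *)
Lemma expR_ge_quadratic {R : realType} (c : R) :
  -2 <= c -> 1 + c + c ^+ 2 / 4 <= expR c.
Proof.
move=> hc.
have -> : expR c = expR (c / 2) ^+ 2 by rewrite -expRM_natl; congr expR; lra.
have h := expR_ge1Dx (c / 2).
have h0 : 0 <= 1 + c / 2 by lra.
have -> : 1 + c + c ^+ 2 / 4 = (1 + c / 2) ^+ 2 by field.
by rewrite lerXn2r // nnegrE // expR_ge0.
Qed.

(** The tangent bound at [- u] gives [expR u * (1 - u) <= 1], and [(1 + u + 2 * u ^+ 2) * (1 - u)]
    is at least 1 on this range. *)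
Lemma expR_le_quadratic {R : realType} (u : R) :
  u <= 2^-1 -> expR u <= 1 + u + 2 * u ^+ 2.
Proof.
move=> hu.
have h := expR_ge1Dx (- u).
have e : expR u * expR (- u) = 1 by rewrite -expRD subrr expR0.
have h0 := expR_gt0 u.
have h1 : expR u * (1 - u) <= 1 by rewrite -[leRHS]e ler_pM2l.
have h2 : 0 < 1 - u by lra.
rewrite -(ler_pM2r h2); apply: le_trans h1 _.
have : 0 <= u ^+ 2 * (1 - 2 * u) by rewrite mulr_ge0 ?sqr_ge0 //; lra.
have -> : (1 + u + 2 * u ^+ 2) * (1 - u) = 1 + u ^+ 2 * (1 - 2 * u) by ring.
by lra.
Qed.

Definition is_dist {R : realType} {n} (w : 'I_n -> R) : Prop :=
  (forall i, 0 <= w i) /\ \sum_i w i = 1.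

Definition dist_mean {R : realType} {n} (w f : 'I_n -> R) : R :=
  \sum_i w i * f i.

Definition dist_var {R : realType} {n} (w f : 'I_n -> R) : R :=
  \sum_i w i * (f i - dist_mean w f) ^+ 2.

(* The probability that two independent draws from [w] differ; it vanishes
   exactly at the point masses. *)
Definition spread {R : realType} {n} (w : 'I_n -> R) : R :=
  \sum_i \sum_j w i * w j * (i != j)%:R.

Lemma dist_mean_bound {R : realType} {n} (w f : 'I_n -> R) (M : R) :
  is_dist w -> (forall i, `|f i| <= M) -> `|dist_mean w f| <= M.
Proof.
move=> [w0 w1] fM; apply: le_trans (ler_norm_sum _ _ _) _.
rewrite -[leRHS]mul1r -w1 mulr_suml; apply: ler_sum => i _.
by rewrite normrM (ger0_norm (w0 i)); apply: ler_wpM2l.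
Qed.

Lemma dist_mean_cst {R : realType} {n} (w : 'I_n -> R) (c : R) :
  is_dist w -> dist_mean w (fun=> c) = c.
Proof. by move=> [_ w1]; rewrite /dist_mean -mulr_suml w1 mul1r. Qed.

Lemma dist_meanD {R : realType} {n} (w f g : 'I_n -> R) :
  dist_mean w (fun i => f i + g i) = dist_mean w f + dist_mean w g.
Proof.
by rewrite /dist_mean -big_split /=; apply: eq_bigr => i _; rewrite mulrDr.
Qed.

Lemma dist_meanZ {R : realType} {n} (w f : 'I_n -> R) (c : R) :
  dist_mean w (fun i => c * f i) = c * dist_mean w f.
Proof.
by rewrite /dist_mean mulr_sumr; apply: eq_bigr => i _; rewrite mulrCA.
Qed.

Lemma dist_mean_le {R : realType} {n} (w f g : 'I_n -> R) :
  is_dist w -> (forall i, f i <= g i) -> dist_mean w f <= dist_mean w g.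
Proof.
by move=> [w0 _] fg; apply: ler_sum => i _; apply: ler_wpM2l.
Qed.

Lemma dist_var_ge0 {R : realType} {n} (w f : 'I_n -> R) :
  is_dist w -> 0 <= dist_var w f.
Proof. by move=> [w0 _]; apply: sumr_ge0 => i _; rewrite mulr_ge0 ?sqr_ge0. Qed.

(** Each [f i - f j] is written as a difference of centred values; the cross terms vanish because
    centred values have mean 0. *)
Lemma dist_var_pairs {R : realType} {n} (w f : 'I_n -> R) :
  is_dist w ->
  2 * dist_var w f = \sum_i \sum_j w i * w j * (f i - f j) ^+ 2.
Proof.
move=> [_ w1]; set m := dist_mean w f.
have centered : \sum_i w i * (f i - m) = 0.
  transitivity (\sum_i (w i * f i - m * w i)).
    by apply: eq_bigr => i _; ring.
  by rewrite sumrB -mulr_sumr w1 mulr1 subrr.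
have eq_i i : \sum_j w i * w j * (f i - f j) ^+ 2 =
    w i * (f i - m) ^+ 2 + w i * dist_var w f.
  transitivity (\sum_j (w i * (f i - m) ^+ 2 * w j + w i * (w j * (f j - m) ^+ 2)
      - 2 * w i * (f i - m) * (w j * (f j - m)))).
    by apply: eq_bigr => j _; ring.
  by rewrite sumrB big_split /= -!mulr_sumr w1 centered mulr1 mulr0 subr0.
rewrite (eq_bigr _ (fun i _ => eq_i i)) big_split /= -mulr_suml w1 mul1r.
by rewrite -/(dist_var w f); ring.
Qed.

(** This is where distinctness of the payoffs enters: when [f] separates the strategies, a small
    variance forces [w] close to a point mass. *)
Lemma dist_var_ge_spread {R : realType} {n} (w f : 'I_n -> R) (d : R) :
  is_dist w -> 0 <= d -> (forall i j, i != j -> d <= `|f i - f j|) ->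
  d ^+ 2 * spread w <= 2 * dist_var w f.
Proof.
move=> dw d0 fd; rewrite dist_var_pairs // mulr_sumr.
apply: ler_sum => i _; rewrite mulr_sumr; apply: ler_sum => j _.
rewrite mulrCA; apply: ler_wpM2l; first by rewrite mulr_ge0 ?dw.1.
have [_|ij] := eqVneq i j; first by rewrite mulr0 sqr_ge0.
by rewrite mulr1 -[leRHS]real_normK ?num_real // lerXn2r ?nnegrE ?fd.
Qed.

Lemma dist_var_le_spread {R : realType} {n} (w f : 'I_n -> R) (M : R) :
  is_dist w -> (forall i j, `|f i - f j| <= M) ->
  2 * dist_var w f <= M ^+ 2 * spread w.
Proof.
move=> dw fM; rewrite dist_var_pairs // mulr_sumr.
apply: ler_sum => i _; rewrite mulr_sumr; apply: ler_sum => j _.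
rewrite [leRHS]mulrCA; apply: ler_wpM2l; first by rewrite mulr_ge0 ?dw.1.
have [->|ij] := eqVneq i j; first by rewrite subrr mulr0 expr0n.
have h := fM i j.
by rewrite mulr1 -[leLHS]real_normK ?num_real // lerXn2r ?nnegrE // (le_trans _ h).
Qed.

Lemma spread_ge0 {R : realType} {n} (w : 'I_n -> R) : is_dist w -> 0 <= spread w.
Proof.
move=> [w0 _]; apply: sumr_ge0 => i _; apply: sumr_ge0 => j _.
by rewrite !mulr_ge0.
Qed.

Lemma spread_le1 {R : realType} {n} (w : 'I_n -> R) : is_dist w -> spread w <= 1.
Proof.
move=> [w0 w1].
have <- : \sum_i \sum_j w i * w j = 1.
  by under eq_bigr do rewrite -mulr_sumr w1 mulr1.
apply: ler_sum => i _; apply: ler_sum => j _.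
by rewrite ler_piMr ?mulr_ge0 // lern1 leq_b1.
Qed.

Lemma spread_eq0 {R : realType} {n} (w : 'I_n -> R) :
  is_dist w -> spread w = 0 -> exists s, forall i, w i = (i == s)%:R.
Proof.
move=> [w0 w1] h.
have pair0 i j : i != j -> w i * w j = 0.
  move=> ij; have := h; rewrite /spread => /eqP.
  rewrite psumr_eq0; last first.
    by move=> k _; apply: sumr_ge0 => l _; rewrite !mulr_ge0.
  move=> /allP /(_ i (mem_index_enum _)) /=.
  rewrite psumr_eq0; last by move=> l _; rewrite !mulr_ge0.
  move=> /allP /(_ j (mem_index_enum _)) /=.
  by rewrite ij mulr1 => /eqP.
have [s ws] : exists s, w s != 0.
  apply/not_existsP => H; move: w1; rewrite big1; last first.
    by move=> i _; have /negP := H i; rewrite negbK => /eqP.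
  by move=> /eqP; rewrite eq_sym oner_eq0.
have off i : i != s -> w i = 0.
  by move=> /pair0 /eqP; rewrite mulf_eq0 (negbTE ws) orbF => /eqP.
exists s => i; have [->|/off //] := eqVneq i s.
by rewrite -w1 (bigD1 s) //= big1 ?addr0.
Qed.

(** A quantitative Jensen inequality: with [expR m] factored out, the linear term of the centred
    exponential averages to 0 and the quadratic one to a multiple of the variance. *)
Lemma ln_partition_ge {R : realType} {n} (w b : 'I_n -> R) :
  is_dist w -> (forall i, `|b i| <= 2^-1) ->
  dist_mean w b + dist_var w b / 8 <= ln (dist_mean w (fun i => expR (b i))).
Proof.
move=> dw hb; have hm := dist_mean_bound w b _ dw hb.
set m := dist_mean w b in hm *; set v := dist_var w b.
have hc i : `|b i - m| <= 1.
  by have := hb i; move: hm; rewrite !ler_norml; lra.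
have v0 : 0 <= v by apply: dist_var_ge0.
have v1 : v <= 1.
  have -> : 1 = dist_mean w (fun=> 1) :> R by rewrite dist_mean_cst.
  apply: dist_mean_le => // i.
  by rewrite -[leLHS]real_normK ?num_real // expr_le1.
have low : expR m * (1 + v / 4) <= dist_mean w (fun i => expR (b i)).
  have -> : dist_mean w (fun i => expR (b i)) =
      expR m * dist_mean w (fun i => expR (b i - m)).
    rewrite -dist_meanZ; congr dist_mean; apply/funext => i.
    by rewrite -expRD; congr expR; lra.
  rewrite ler_pM2l ?expR_gt0 //.
  have -> : 1 + v / 4 =
      dist_mean w (fun i => 1 + (b i - m) + (b i - m) ^+ 2 / 4).
    rewrite !dist_meanD !dist_mean_cst // -/m subrr addr0.
    congr (_ + _); rewrite /v /dist_var mulr_suml.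
    by apply: eq_bigr => i _; rewrite mulrA.
  apply: dist_mean_le => // i; apply: expR_ge_quadratic.
  by have := hc i; rewrite ler_norml; lra.
rewrite -[leLHS]expRK ler_ln ?posrE ?expR_gt0 //; last first.
  by apply: lt_le_trans low; rewrite mulr_gt0 ?expR_gt0 //; lra.
apply: le_trans low; rewrite expRD ler_pM2l ?expR_gt0 //.
(* Since [v <= 1], the quadratic bound gives [expR (v / 8) <= 1 + v / 8 + v ^+ 2 / 32 <= 1 + v /
   4]. *)
have : v / 8 <= 2^-1 by lra.
by move=> /expR_le_quadratic /le_trans; apply; nra.
Qed.

Lemma ln_partition_bound {R : realType} {n} (w b : 'I_n -> R) (M : R) :
  is_dist w -> (forall i, `|b i| <= M) ->
  `|ln (dist_mean w (fun i => expR (b i)))| <= M.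
Proof.
move=> dw hb.
have lo : expR (- M) <= dist_mean w (fun i => expR (b i)).
  rewrite -(dist_mean_cst w (expR (- M)) dw); apply: dist_mean_le => // i.
  by rewrite ler_expR; have := hb i; rewrite ler_norml => /andP[].
have up : dist_mean w (fun i => expR (b i)) <= expR M.
  rewrite -(dist_mean_cst w (expR M) dw); apply: dist_mean_le => // i.
  by rewrite ler_expR; have := hb i; rewrite ler_norml => /andP[].
have pos : 0 < dist_mean w (fun i => expR (b i)) := lt_le_trans (expR_gt0 _) lo.
rewrite ler_norml -{1}(expRK (- M)) -{2}(expRK M).
by rewrite !ler_ln ?posrE ?expR_gt0 // lo up.
Qed.

(** After centring, the first-order term averages to 0. Keeping the variance in the second-order
    term, rather than a constant, makes the error vanish at point masses. *)
Lemma dist_mean_expR_le {R : realType} {n} (w f : 'I_n -> R) (delta : R) :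
  is_dist w -> (forall i, `|f i| <= 1) -> 0 <= delta -> delta <= 4^-1 ->
  dist_mean w (fun i => expR (delta * f i)) <=
  expR (delta * dist_mean w f + 2 * delta ^+ 2 * dist_var w f).
Proof.
move=> dw hf d0 d1; have hm := dist_mean_bound w f _ dw hf.
set m := dist_mean w f in hm *; set v := dist_var w f.
have -> : dist_mean w (fun i => expR (delta * f i)) =
    expR (delta * m) * dist_mean w (fun i => expR (delta * (f i - m))).
  rewrite -dist_meanZ; congr dist_mean; apply/funext => i.
  by rewrite -expRD; congr expR; ring.
rewrite expRD ler_pM2l ?expR_gt0 //.
apply: le_trans (expR_ge1Dx _).
have -> : 1 + 2 * delta ^+ 2 * v = dist_mean w (fun i =>
    1 + delta * (f i - m) + (2 * delta ^+ 2) * (f i - m) ^+ 2).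
  rewrite !dist_meanD !dist_meanZ dist_meanD !dist_mean_cst // -/m subrr mulr0.
  by rewrite addr0.
apply: dist_mean_le => // i.
have hfm : delta * (f i - m) <= 2^-1.
  have : f i - m <= 2 by have := hf i; move: hm; rewrite !ler_norml; lra.
  by nra.
by apply: le_trans (expR_le_quadratic _ hfm) _; rewrite exprMn mulrA.
Qed.

(** * Faces of the space of mixed profiles *)

Definition face {R : realType} {n1 n2} (S1 : {set 'I_n1}) (S2 : {set 'I_n2}) :
    set (profile R n1 n2) :=
  [set x | [/\ mixedX x, forall i, i \notin S1 -> x.1 ord0 i = 0 &
    forall j, j \notin S2 -> x.2 ord0 j = 0]].

Lemma face_sub_mixedX {R : realType} {n1 n2} (S1 : {set 'I_n1})
  (S2 : {set 'I_n2}) : face S1 S2 `<=` @mixedX R n1 n2.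
Proof. by move=> x []. Qed.

Lemma mixedX_dist {R : realType} {n1 n2} (x : profile R n1 n2) :
  mixedX x -> is_dist (x.1 ord0) /\ is_dist (x.2 ord0).
Proof. by []. Qed.

Lemma dist_le1 {R : realType} {n} (w : 'I_n -> R) i : is_dist w -> w i <= 1.
Proof.
by move=> [w0 <-]; rewrite (bigD1 i) //= lerDl; apply: sumr_ge0 => j _.
Qed.

Lemma continuous_coord1 {R : realType} {n1 n2} (i : 'I_n1) :
  continuous (fun x : profile R n1 n2 => x.1 ord0 i).
Proof.
move=> x; apply: (@continuous_comp _ _ _ fst (fun v : 'rV[R]_n1 => v ord0 i)).
  exact: cvg_fst.
exact: coord_continuous.
Qed.

Lemma continuous_coord2 {R : realType} {n1 n2} (j : 'I_n2) :
  continuous (fun x : profile R n1 n2 => x.2 ord0 j).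
Proof.
move=> x; apply: (@continuous_comp _ _ _ snd (fun v : 'rV[R]_n2 => v ord0 j)).
  exact: cvg_snd.
exact: coord_continuous.
Qed.

Lemma continuous_sum {R : realType} {T : topologicalType} {I : Type}
    (r : seq I) (P : pred I) (f : I -> T -> R) :
  (forall i, P i -> continuous (f i)) ->
  continuous (fun x => \sum_(i <- r | P i) f i x).
Proof. by move=> cf; apply: continuous_big => //; exact: add_continuous. Qed.

Lemma continuous_prod {R : realType} {T : topologicalType} {I : Type}
    (r : seq I) (P : pred I) (f : I -> T -> R) :
  (forall i, P i -> continuous (f i)) ->
  continuous (fun x => \prod_(i <- r | P i) f i x).
Proof. by move=> cf; apply: continuous_big => //; exact: mul_continuous. Qed.

Lemma continuous_mul {R : realType} {T : topologicalType} (f g : T -> R) :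
  continuous f -> continuous g -> continuous (fun x => f x * g x).
Proof. by move=> cf cg x; apply: cvgM; [exact: cf | exact: cg]. Qed.

Lemma closed_forall {T : topologicalType} {I : Type} (P : I -> set T) :
  (forall i, closed (P i)) -> closed [set x | forall i, P i x].
Proof.
move=> cP; rewrite (_ : [set x | _] = \bigcap_(i in setT) P i).
  by apply: closed_bigI => i _; exact: cP.
by apply/seteqP; split => [x H i _ | x H i]; apply: H.
Qed.

Lemma closed_level {R : realType} {T : topologicalType} (f : T -> R) (c : R) :
  continuous f -> closed [set x | f x = c].
Proof.
move=> cf; rewrite (_ : [set x | _] = f @^-1` [set c]) //.
by apply: closed_comp => [x _|]; [exact: cf | exact: closed_eq].
Qed.

Lemma closed_mixedX {R : realType} {n1 n2} : closed (@mixedX R n1 n2).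
Proof.
rewrite (_ : @mixedX R n1 n2 =
  [set x : profile R n1 n2 | forall i, 0 <= x.1 ord0 i] `&`
  [set x : profile R n1 n2 | \sum_i x.1 ord0 i = 1] `&`
  ([set x : profile R n1 n2 | forall j, 0 <= x.2 ord0 j] `&`
   [set x : profile R n1 n2 | \sum_j x.2 ord0 j = 1])).
  apply: closedI; apply: closedI.
  - apply: closed_forall => i; apply: (closed_comp (D := [set t : R | 0 <= t])).
      by move=> x _; exact: continuous_coord1.
    exact: closed_ge.
  - by apply: closed_level; apply: continuous_sum => i _; exact: continuous_coord1.
  - apply: closed_forall => i; apply: (closed_comp (D := [set t : R | 0 <= t])).
      by move=> x _; exact: continuous_coord2.
    exact: closed_ge.
  - by apply: closed_level; apply: continuous_sum => i _; exact: continuous_coord2.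
by apply/seteqP; split.
Qed.

Lemma compact_mixedX {R : realType} {n1 n2} : compact (@mixedX R n1 n2).
Proof.
pose box n := [set v : 'rV[R]_n | forall i, v ord0 i \in `[0, 1]].
have cbox n : compact (box n).
  by apply: (@rV_compact R n (fun=> `[(0 : R), 1]%classic)) => _; exact: segment_compact.
apply: (@subclosed_compact _ _ (box n1 `*` box n2)).
- exact: closed_mixedX.
- by apply: compact_setX; exact: cbox.
- move=> x /mixedX_dist[d1 d2]; split => i; rewrite /= in_itv /=.
    by rewrite d1.1 (dist_le1 _ _ d1).
  by rewrite d2.1 (dist_le1 _ _ d2).
Qed.

Lemma compact_face {R : realType} {n1 n2} (S1 : {set 'I_n1}) (S2 : {set 'I_n2}) :
  compact (face S1 S2 : set (profile R n1 n2)).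
Proof.
apply: (subclosed_compact _ compact_mixedX (@face_sub_mixedX _ _ _ _ _)).
rewrite (_ : face S1 S2 = @mixedX R n1 n2 `&`
  ([set x : profile R n1 n2 | forall i, i \notin S1 -> x.1 ord0 i = 0] `&`
   [set x : profile R n1 n2 | forall j, j \notin S2 -> x.2 ord0 j = 0])); last first.
  by apply/seteqP; split => x; [case | case=> ? []].
apply: closedI; first exact: closed_mixedX.
apply: closedI; apply: closed_forall => i; apply: closed_forall => _.
  by apply: closed_level; exact: continuous_coord1.
by apply: closed_level; exact: continuous_coord2.
Qed.

(** * Invariance of faces and the Feller property of the chain *)

Lemma cvg_row {R : realType} {T : Type} {F : set_system T} {FF : Filter F} {n}
    (f : T -> 'rV[R]_n) (v : 'rV[R]_n) :
  (forall i, f x ord0 i @[x --> F] --> v ord0 i) -> f @ F --> v.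
Proof.
move=> cf A [B nB BA]; apply: (filterS BA).
have : \forall x \near F, forall i, B ord0 i (f x ord0 i).
  by apply: filter_forall => i; apply: cf; exact: nB.
by apply: filterS => x H i j; rewrite (ord1 i).
Qed.

Lemma partition_gt0 {R : realType} {n} (w b : 'I_n -> R) :
  is_dist w -> 0 < \sum_k w k * expR (b k).
Proof.
move=> dw; have [k wk] : exists k, 0 < w k.
  apply/not_existsP => H; have := dw.2; rewrite big1.
    by move=> /eqP; rewrite eq_sym oner_eq0.
  by move=> i _; apply/eqP; rewrite eq_le dw.1 andbT leNgt; apply/negP/H.
rewrite (bigD1 k) //=; apply: ltr_pwDl; first by rewrite mulr_gt0 ?expR_gt0.
by apply: sumr_ge0 => i _; rewrite mulr_ge0 ?expR_ge0 ?dw.1.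
Qed.

(** A multiplicative update never revives a zero coordinate, which makes induction on faces
    possible. *)
Lemma mwu_step_face {R : realType} {n1 n2} (A : 'M[R]_(n1, n2)) (eta : R)
    (S1 : {set 'I_n1}) (S2 : {set 'I_n2}) (x : profile R n1 n2) s1 s2 :
  face S1 S2 x -> face S1 S2 (mwu_step A eta x s1 s2).
Proof.
case=> /mixedX_dist[d1 d2] z1 z2.
have Z1 := partition_gt0 _ (fun k => eta * A k s2) d1.
have Z2 := partition_gt0 _ (fun k => eta * (- A s1 k)) d2.
split.
- split; split => /=.
  + by move=> i; rewrite mxE divr_ge0 ?mulr_ge0 ?expR_ge0 ?d1.1 // ltW.
  + under eq_bigr do rewrite mxE.
    by rewrite -mulr_suml divff // gt_eqF.
  + by move=> i; rewrite mxE divr_ge0 ?mulr_ge0 ?expR_ge0 ?d2.1 // ltW.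
  + under eq_bigr do rewrite mxE.
    by rewrite -mulr_suml divff // gt_eqF.
- by move=> i /z1 e; rewrite /= mxE e !mul0r.
- by move=> i /z2 e; rewrite /= mxE e !mul0r.
Qed.

Lemma faceT {R : realType} {n1 n2} : face [set: 'I_n1]%SET [set: 'I_n2]%SET = @mixedX R n1 n2.
Proof.
apply/seteqP; split => [x []//|x X]; split => // i.
  by rewrite finset.in_setT.
by rewrite finset.in_setT.
Qed.

Lemma mwu_step_mixedX {R : realType} {n1 n2} (A : 'M[R]_(n1, n2)) (eta : R)
    (x : profile R n1 n2) s1 s2 :
  mixedX x -> mixedX (mwu_step A eta x s1 s2).
Proof. by rewrite -faceT; exact: mwu_step_face. Qed.

(** At a point of [mixedX] both normalising sums are positive, so the divisions are continuous
    there. *)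
Lemma mwu_step_continuous {R : realType} {n1 n2} (A : 'M[R]_(n1, n2)) (eta : R)
    (x : profile R n1 n2) s1 s2 :
  mixedX x -> {for x, continuous (fun y => mwu_step A eta y s1 s2)}.
Proof.
move=> /mixedX_dist[d1 d2].
have Z1 := partition_gt0 _ (fun k => eta * A k s2) d1.
have Z2 := partition_gt0 _ (fun k => eta * (- A s1 k)) d2.
rewrite /continuous_at /mwu_step.
apply: (@cvg_pair _ _ _ (nbhs x) (nbhs (mwu_step A eta x s1 s2).1)
  (nbhs (mwu_step A eta x s1 s2).2)); apply: cvg_row => i /=.
- under eq_cvg do rewrite mxE; rewrite mxE.
  apply: cvgM; first by apply: cvgMl; exact: continuous_coord1.
  apply: cvgV; first by rewrite gt_eqF.
  apply: continuous_sum => k _ y; apply: cvgMl; exact: continuous_coord1.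
- under eq_cvg do rewrite mxE; rewrite mxE.
  apply: cvgM; first by apply: cvgMl; exact: continuous_coord2.
  apply: cvgV; first by rewrite gt_eqF.
  apply: continuous_sum => k _ y; apply: cvgMl; exact: continuous_coord2.
Qed.

Lemma within_comp_mwu_step {R : realType} {n1 n2} (A : 'M[R]_(n1, n2)) (eta : R)
    (f : profile R n1 n2 -> R) s1 s2 :
  {within @mixedX R n1 n2, continuous f} ->
  {within @mixedX R n1 n2, continuous (fun x => f (mwu_step A eta x s1 s2))}.
Proof.
move=> /subspace_continuousP cf; apply/subspace_continuousP => x Xx.
apply: (cvg_comp _ _ _ (cf _ (mwu_step_mixedX A eta x s1 s2 Xx))) => B nB.
have := mwu_step_continuous A eta x s1 s2 Xx _ nB.
rewrite /within /= /nbhs /=.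
by apply: filterS => y H Xy; apply: H; exact: mwu_step_mixedX.
Qed.

Lemma within_expect {R : realType} {n1 n2} (A : 'M[R]_(n1, n2)) (eta : R)
    (f : profile R n1 n2 -> R) t :
  {within @mixedX R n1 n2, continuous f} ->
  {within @mixedX R n1 n2, continuous (expect A eta t f)}.
Proof.
move=> cf; elim: t => [//|t IH] /=.
apply: continuous_sum => s1 _; apply: continuous_sum => s2 _.
apply: continuous_mul; last exact: within_comp_mwu_step.
apply: continuous_subspaceT; apply: continuous_mul.
  exact: continuous_coord1.
exact: continuous_coord2.
Qed.

Lemma within_avg_expect {R : realType} {n1 n2} (A : 'M[R]_(n1, n2)) (eta : R)
    (f : profile R n1 n2 -> R) T :
  {within @mixedX R n1 n2, continuous f} ->
  {within @mixedX R n1 n2, continuous (avg_expect A eta T f)}.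
Proof.
move=> cf; apply: continuous_mul; first by move=> ?; exact: cvg_cst.
by apply: continuous_sum => t _; exact: within_expect.
Qed.

(** The function [u], which is [g] plus twice the positive part of [e - f], is positive on [K] and
    so has a positive minimum. Where [f] exceeds [e] it equals [g], so [C] can be the maximum of [f]
    (or 0) divided by that minimum. *)
Lemma compact_domination {R : realType} {T : topologicalType} (K : set T)
    (f g : T -> R) (e : R) :
  0 <= e -> compact K ->
  {within K, continuous f} -> {within K, continuous g} ->
  (forall x, K x -> 0 <= g x) -> (forall x, K x -> g x = 0 -> f x < e) ->
  exists2 C : R, 0 <= C & forall x, K x -> f x <= e + C * g x.
Proof.
move=> e0 cK cf cg g0 fe.
have [K0|/set0P/negP K0] := pselect (K !=set0); last first.
  by exists 0 => // x Kx; move: K0; rewrite negbK => /eqP K0; move: Kx; rewrite K0.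
have [b bK fb] := compact_EVT_max K0 cK cf.
pose u x := g x + (e - f x + `|e - f x|).
have cu : {within K, continuous u}.
  move=> x; apply: cvgD; first exact: cg.
  have cef : e - f y @[y --> x] --> e - f x.
    by apply: cvgB; [exact: cvg_cst | exact: cf].
  by apply: cvgD => //; exact: cvg_norm.
have [a aK ua] := compact_EVT_min K0 cK cu.
have ua0 : 0 < u a.
  move: aK; rewrite inE => Ka.
  have := g0 _ Ka; rewrite le_eqVlt => /orP[/eqP ga|ga]; rewrite /u.
    by have := fe _ Ka (esym ga); have := normr_ge0 (e - f a); lra.
  by have := ler_norm (- (e - f a)); rewrite normrN; lra.
pose C := Num.max (f b) 0 / u a.
have C0 : 0 <= C by rewrite divr_ge0 ?le_max ?lexx ?orbT // ltW.
exists C => // x Kx; have [fx|fx] := leP (f x) e.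
  by apply: le_trans fx _; rewrite lerDl mulr_ge0 // g0.
have ux : u x = g x by rewrite /u ler0_norm ?subrr ?addr0 // subr_le0 ltW.
have uax : u a <= g x by rewrite -ux ua // inE.
have : f x <= C * u a.
  by rewrite /C divfK ?gt_eqF // le_max fb // inE.
have : C * u a <= C * g x by apply: ler_wpM2l.
by lra.
Qed.

(** * Equilibria of the reversed game on a face *)

Lemma pure_face {R : realType} {n1 n2} (S1 : {set 'I_n1}) (S2 : {set 'I_n2}) s1 s2 :
  s1 \in S1 -> s2 \in S2 ->
  face S1 S2 (delta_mx ord0 s1, delta_mx ord0 s2 : 'rV[R]_n2).
Proof.
have dist_delta n (s : 'I_n) : in_simplex (delta_mx ord0 s : 'rV[R]_n).
  split => [i|]; first by rewrite mxE ler0n.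
  rewrite (bigD1 s) //= big1 ?addr0 ?mxE ?eqxx // => i /negbTE is_.
  by rewrite mxE is_ andbF.
move=> s1S s2S; split => [|i iS|i iS] /=.
- by split; exact: dist_delta.
- by rewrite mxE; have [e|_] := eqVneq i s1; [rewrite e s1S in iS | rewrite andbF].
- by rewrite mxE; have [e|_] := eqVneq i s2; [rewrite e s2S in iS | rewrite andbF].
Qed.

Lemma face_convex {R : realType} {n1 n2} (S1 : {set 'I_n1}) (S2 : {set 'I_n2})
    (e : R) (x y : profile R n1 n2) : 0 <= e <= 1 ->
  face S1 S2 x -> face S1 S2 y ->
  face S1 S2 ((1 - e) *: x.1 + e *: y.1, (1 - e) *: x.2 + e *: y.2).
Proof.
move=> /andP[e0 e1].
have e1' : 0 <= 1 - e by rewrite subr_ge0.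
have cvx n (u v : 'rV[R]_n) : in_simplex u -> in_simplex v ->
    in_simplex ((1 - e) *: u + e *: v).
  move=> [u0 u1] [v0 v1]; split => [i|].
    by rewrite !mxE addr_ge0 ?mulr_ge0.
  under eq_bigr do rewrite !mxE.
  by rewrite big_split /= -!mulr_sumr u1 v1 !mulr1 subrK.
case=> -[x1 x2] zx1 zx2 [[y1 y2] zy1 zy2]; split => /=.
- by split; apply: cvx.
- by move=> i iS; rewrite !mxE zx1 // zy1 // !mulr0 addr0.
- by move=> i iS; rewrite !mxE zx2 // zy2 // !mulr0 addr0.
Qed.

Lemma continuous_max0 {R : realType} {T : topologicalType} (f : T -> R) :
  continuous f -> continuous (fun x => Num.max (f x) 0).
Proof.
move=> cf x; rewrite /continuous_at; under eq_cvg do rewrite maxr_absE subr0 addr0.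
rewrite maxr_absE subr0 addr0; apply: cvgMl.
by apply: cvgD; [exact: cf | apply: cvg_norm; exact: cf].
Qed.

(* Von Neumann's theorem for the game with matrix [- A] restricted to the face:
   [z.1] minimises its own maximal payoff. At a minimiser of the total squared
   violation [sum_a w_a ^ 2], the first-order conditions towards the pure
   profiles [b], averaged with weights [w_b], give
   [sum_b w_b * sum_a w_a ^ 2 <= 0] because the bilinear part is antisymmetric
   under exchanging [a] and [b]. *)
Lemma anti_equilibrium {R : realType} {n1 n2} (A : 'M[R]_(n1, n2))
    (S1 : {set 'I_n1}) (S2 : {set 'I_n2}) k0 l0 :
  k0 \in S1 -> l0 \in S2 ->
  exists2 z : profile R n1 n2, face S1 S2 z &
    forall i j, i \in S1 -> j \in S2 ->
      \sum_k z.1 ord0 k * A k j <= \sum_l z.2 ord0 l * A i l.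
Proof.
move=> k0S l0S.
pose t (z : profile R n1 n2) (a : 'I_n1 * 'I_n2) : R :=
  \sum_k z.1 ord0 k * A k a.2 - \sum_l z.2 ord0 l * A a.1 l.
pose w z a : R := Num.max (t z a) 0.
pose D := [pred a : 'I_n1 * 'I_n2 | (a.1 \in S1) && (a.2 \in S2)].
pose Psi z : R := \sum_(a | D a) w z a * w z a.
have ct a : continuous (t ^~ a).
  move=> z; apply: cvgB.
    by apply: continuous_sum => k _ y; apply: cvgMl; exact: continuous_coord1.
  by apply: continuous_sum => k _ y; apply: cvgMl; exact: continuous_coord2.
have cPsi : continuous Psi.
  by apply: continuous_sum => a _; apply: continuous_mul; apply: continuous_max0.
have [z] : exists2 z, z \in face S1 S2 &
    forall y, y \in face S1 S2 -> Psi z <= Psi y.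
  apply: compact_EVT_min; last exact: continuous_subspaceT.
    by eexists; exact: (pure_face _ _ _ _ k0S l0S).
  exact: compact_face.
rewrite inE => Fz minz; exists z => //.
have w0 a : 0 <= w z a by rewrite le_max lexx orbT.
have wt a : w z a * t z a = w z a ^+ 2.
  rewrite /w; case: (leP (t z a) 0) => _; last by rewrite expr2.
  by rewrite mul0r expr0n.
pose c (a b : 'I_n1 * 'I_n2) : R := A b.1 a.2 - A a.1 b.2.
have first_order b : D b -> \sum_(a | D a) w z a ^+ 2 <=
    \sum_(a | D a) w z a * c a b.
  move=> /andP[b1 b2].
  pose d a := c a b - t z a.
  suff : 0 <= \sum_(a | D a) w z a * d a.
    under eq_bigr do rewrite /d mulrBr wt.
    by rewrite sumrB subr_ge0.
  set s1 := \sum_(a | D a) _; set s2 := \sum_(a | D a) d a ^+ 2.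
  have s20 : 0 <= s2 by apply: sumr_ge0 => a _; exact: sqr_ge0.
  (* Moving from [z] by a fraction [e] towards the pure profile [b] changes each [t z a] by
     [e * d a]; minimality of [Psi z] bounds the resulting change from below by 0. *)
  have quad e : 0 <= e <= 1 -> 0 <= 2 * e * s1 + e ^+ 2 * s2.
    move=> e01; have e0 : 0 <= e by case/andP: e01.
    pose y : profile R n1 n2 :=
      ((1 - e) *: z.1 + e *: delta_mx ord0 b.1,
       (1 - e) *: z.2 + e *: delta_mx ord0 b.2).
    have Fy : face S1 S2 y.
      exact: (face_convex _ _ e z (delta_mx ord0 b.1, delta_mx ord0 b.2)
        e01 Fz (pure_face _ _ _ _ b1 b2)).
    have ty a : t y a = t z a + e * d a.
      rewrite /d /c /t /=.
      have pick n (u : 'rV[R]_n) (s : 'I_n) (g : 'I_n -> R) :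
          \sum_k ((1 - e) *: u + e *: delta_mx ord0 s) ord0 k * g k =
          (1 - e) * (\sum_k u ord0 k * g k) + e * g s.
        transitivity (\sum_k ((1 - e) * (u ord0 k * g k) +
            e * ((k == s)%:R * g k))).
          by apply: eq_bigr => k _; rewrite !mxE eqxx /=; ring.
        rewrite big_split /= -!mulr_sumr; congr (_ + _ * _).
        rewrite (bigD1 s) //= big1 ?addr0 ?eqxx ?mul1r // => k /negbTE ->.
        by rewrite mul0r.
      by rewrite (pick _ _ _ (fun k => A k a.2)) (pick _ _ _ (fun k => A a.1 k)); ring.
    have := minz y; rewrite inE => /(_ Fy).
    rewrite -subr_ge0 => /le_trans; apply.
    rewrite /Psi -sumrB /s1 /s2 !mulr_sumr -big_split /=.
    apply: ler_sum => a _; rewrite /w ty.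
    (* For positive parts, the square at [T + e * dd] is at most the square at [T], plus
       [2 * e * dd] times the positive part of [T], plus [(e * dd) ^+ 2]. *)
    set T := t z a; set dd := d a.
    have [T0|T0] := leP T 0; have [Td|Td] := leP (T + e * dd) 0;
      have := sqr_ge0 (e * dd); have := sqr_ge0 (T + e * dd); nra.
  rewrite leNgt; apply/negP => s1_lt0.
  (* For [s1 < 0] this value lies in []0, 1]] and satisfies [e * s2 < - s1], which makes
     [2 * s1 + e * s2] negative. *)
  have := quad (- s1 / (s2 - s1 + 1)).
  have h : 0 < s2 - s1 + 1 by lra.
  set e := - s1 / _.
  have es : e * (s2 - s1 + 1) = - s1 by rewrite /e divfK // gt_eqF.
  have e_gt0 : 0 < e by rewrite divr_gt0 //; lra.
  have e_le1 : e <= 1 by rewrite ler_pdivrMr // mul1r; lra.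
  rewrite (ltW e_gt0) e_le1 => /(_ isT).
  have -> : 2 * e * s1 + e ^+ 2 * s2 = e * (2 * s1 + e * s2) by ring.
  by rewrite pmulr_rge0 // => k; nra.
have anti : \sum_(b | D b) w z b * (\sum_(a | D a) w z a * c a b) = 0.
  set S := LHS.
  suff : S = - S by lra.
  rewrite {1}/S.
  under eq_bigr do rewrite mulr_sumr.
  rewrite exchange_big /= /S -sumrN; apply: eq_bigr => a _.
  rewrite mulr_sumr -sumrN; apply: eq_bigr => b _.
  by rewrite /c; ring.
have : (\sum_(b | D b) w z b) * (\sum_(a | D a) w z a ^+ 2) <= 0.
  rewrite mulr_suml -[leRHS]anti; apply: ler_sum => b Db.
  by apply: ler_wpM2l => //; exact: first_order.
move=> le0 i j iS jS; rewrite leNgt; apply/negP => viol.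
have Dij : D (i, j) by rewrite /= iS jS.
have wij : 0 < w z (i, j) by rewrite lt_max subr_gt0 viol.
move: le0; rewrite leNgt => /negP; apply; apply: mulr_gt0.
  rewrite (bigD1 (i, j)) //=; apply: ltr_pwDl => //.
  by apply: sumr_ge0.
rewrite (bigD1 (i, j)) //=; apply: ltr_pwDl; first by rewrite exprn_gt0.
by apply: sumr_ge0 => a _; exact: sqr_ge0.
Qed.

(** * The Lyapunov function of a face *)

(* The drift of [sum_i p_i * ln w_i] when [w] is reweighted by [expR \o b]. *)
Definition log_gain {R : realType} {n} (p w b : 'I_n -> R) : R :=
  dist_mean p b - ln (dist_mean w (fun k => expR (b k))).

(** The exponential of [delta * \sum_i p i * ln (w i)], in a form that stays meaningful on the
    boundary: for [delta != 0] it is 0 once a coordinate with [p i != 0] vanishes, and coordinates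
    with [p i = 0] contribute 1. *)
Definition geo_mean {R : realType} {n} (p w : 'I_n -> R) (delta : R) : R :=
  \prod_i w i `^ (delta * p i).

(** Since [p] sums to 1, the common normaliser comes out with exponent exactly [delta]. *)
Lemma geo_mean_step {R : realType} {n} (p w b : 'I_n -> R) (delta : R) :
  is_dist p -> is_dist w ->
  geo_mean p (fun i => w i * expR (b i) / \sum_k w k * expR (b k)) delta =
  geo_mean p w delta * expR (delta * log_gain p w b).
Proof.
move=> dp dw; have Z0 := partition_gt0 _ b dw; rewrite /geo_mean.
have -> : delta * log_gain p w b =
    \sum_i (b i - ln (\sum_k w k * expR (b k))) * (delta * p i).
  rewrite /log_gain /dist_mean mulrBr mulr_sumr -[X in delta * X]mulr1 -dp.2.
  rewrite mulrA mulr_sumr -sumrB; apply: eq_bigr => i _; ring.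
rewrite expR_sum -big_split /=; apply: eq_bigr => i _.
rewrite -mulrA powRM ?dw.1 ?divr_ge0 ?expR_ge0 ?(ltW Z0) //.
by rewrite expRM expRD expRN lnK ?posrE.
Qed.

Lemma geo_mean_ge0 {R : realType} {n} (p w : 'I_n -> R) (delta : R) :
  0 <= geo_mean p w delta.
Proof. by apply: prodr_ge0 => i _; exact: powR_ge0. Qed.

Lemma geo_mean_le1 {R : realType} {n} (p w : 'I_n -> R) (delta : R) :
  is_dist p -> is_dist w -> 0 <= delta -> geo_mean p w delta <= 1.
Proof.
move=> dp dw d0; apply: prodr_ile1 => i _; rewrite powR_ge0 /=.
apply: (@le_trans _ _ (1 `^ (delta * p i))); last by rewrite powR1.
apply: ge0_ler_powR; rewrite ?nnegrE ?mulr_ge0 ?dp.1 ?dw.1 //.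
exact: dist_le1.
Qed.

(** Exponents in [[0, 1]] do not decrease numbers of [[0, 1]]. The lower bound is a polynomial,
    hence visibly continuous. *)
Lemma geo_mean_ge_prod {R : realType} {n} (p w : 'I_n -> R) (delta : R) :
  is_dist p -> is_dist w -> 0 <= delta <= 1 ->
  \prod_(i | p i != 0) w i <= geo_mean p w delta.
Proof.
move=> dp dw /andP[d0 d1]; rewrite /geo_mean big_mkcond /=.
apply: ler_prod => i _; have [->|pi0] := eqVneq (p i) 0.
  by rewrite mulr0 powRr0 ler01 lexx.
rewrite dw.1 /=; have := dw.1 i; rewrite le_eqVlt => /orP[/eqP <-|wi].
  exact: powR_ge0.
apply: ger1_powR; first by rewrite wi dist_le1.
by rewrite mulr_ile1 ?dp.1 ?dist_le1.
Qed.

Lemma log_gain_bound {R : realType} {n} (p w b : 'I_n -> R) :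
  is_dist p -> is_dist w -> (forall i, `|b i| <= 2^-1) -> `|log_gain p w b| <= 1.
Proof.
move=> dp dw hb; apply: le_trans (ler_normB _ _) _.
have := dist_mean_bound _ _ _ dp hb; have := ln_partition_bound _ _ _ dw hb.
lra.
Qed.

Lemma log_gain_le {R : realType} {n} (p w b : 'I_n -> R) (d : R) :
  is_dist w -> (forall i, `|b i| <= 2^-1) ->
  0 <= d -> (forall i j, i != j -> d <= `|b i - b j|) ->
  log_gain p w b <= dist_mean p b - dist_mean w b - d ^+ 2 / 16 * spread w.
Proof.
move=> dw hb d0 hd; have := ln_partition_ge _ _ dw hb.
by have := dist_var_ge_spread _ _ _ dw d0 hd; rewrite /log_gain; lra.
Qed.

Lemma dist_mean_expR_le_spread {R : realType} {n} (w f : 'I_n -> R) (delta : R) :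
  is_dist w -> (forall i, `|f i| <= 1) -> 0 <= delta -> delta <= 4^-1 ->
  dist_mean w (fun i => expR (delta * f i)) <=
  expR (delta * dist_mean w f + 4 * delta ^+ 2 * spread w).
Proof.
move=> dw hf d0 d1; apply: le_trans (dist_mean_expR_le _ _ _ dw hf d0 d1) _.
rewrite ler_expR lerD2l.
have hf2 i j : `|f i - f j| <= 2.
  by apply: le_trans (ler_normB _ _) _; have := hf i; have := hf j; lra.
have := dist_var_le_spread _ _ _ dw hf2.
have : 0 <= delta ^+ 2 by exact: sqr_ge0.
have -> : (2 : R) ^+ 2 = 4 by ring.
by nra.
Qed.

(** A continuous lower bound for the decay of the Lyapunov function; its zeros in a face are the
    pure profiles and the points where a strategy charged by [z] has died out. *)
Definition face_weight {R : realType} {n1 n2} (z x : profile R n1 n2) : R :=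
  (spread (x.1 ord0) + spread (x.2 ord0)) *
  (\prod_(i | z.1 ord0 i != 0) x.1 ord0 i *
   \prod_(j | z.2 ord0 j != 0) x.2 ord0 j).

Lemma dist_mean_exchange {R : realType} {n1 n2} (w1 : 'I_n1 -> R)
    (w2 : 'I_n2 -> R) (f : 'I_n1 -> 'I_n2 -> R) :
  dist_mean w1 (fun i => dist_mean w2 (f i)) =
  dist_mean w2 (fun j => dist_mean w1 (f ^~ j)).
Proof.
rewrite /dist_mean.
under eq_bigr do rewrite mulr_sumr.
rewrite exchange_big /=; apply: eq_bigr => j _; rewrite mulr_sumr.
by apply: eq_bigr => i _; rewrite mulrCA.
Qed.

(* Against the anti-equilibrium [z], the first-order drift of
   [sum_i p_i * ln x_i + sum_j q_j * ln y_j] is nonpositive, and the Jensen gaps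
   make it at most [- d ^+ 2 / 16 * H], where [H] is the total spread. *)
Lemma anti_equilibrium_drift {R : realType} {n1 n2} (A : 'M[R]_(n1, n2))
    (eta d : R) (S1 : {set 'I_n1}) (S2 : {set 'I_n2}) (z x : profile R n1 n2) :
  0 <= eta -> (forall i j, `|eta * A i j| <= 2^-1) -> 0 <= d ->
  (forall i k j, i != k -> d <= `|eta * A i j - eta * A k j|) ->
  (forall i j l, j != l -> d <= `|eta * A i j - eta * A i l|) ->
  mixedX z -> face S1 S2 x ->
  (forall i j, i \in S1 -> j \in S2 ->
    \sum_k z.1 ord0 k * A k j <= \sum_l z.2 ord0 l * A i l) ->
  dist_mean (x.2 ord0)
    (fun s => log_gain (z.1 ord0) (x.1 ord0) (fun k => eta * A k s)) +
  dist_mean (x.1 ord0)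
    (fun s => log_gain (z.2 ord0) (x.2 ord0) (fun k => eta * - A s k)) <=
  - (d ^+ 2 / 16 * (spread (x.1 ord0) + spread (x.2 ord0))).
Proof.
move=> eta0 hA d0 hd1 hd2 /mixedX_dist[p1 p2] [/mixedX_dist[x1 x2] zx1 zx2] hz.
set p := z.1 ord0 in p1 *; set q := z.2 ord0 in p2 *.
set u := x.1 ord0 in x1 *; set v := x.2 ord0 in x2 *.
have hA' s k : `|eta * - A s k| <= 2^-1 by rewrite mulrN normrN.
have hd2' s i j : i != j -> d <= `|eta * - A s i - eta * - A s j|.
  by move=> ij; rewrite !mulrN -opprD normrN; exact: hd2.
set c := d ^+ 2 / 16.
have E1 : dist_mean v (fun s => log_gain p u (fun k => eta * A k s)) <=
    dist_mean v (fun s => dist_mean p (fun k => eta * A k s)) -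
    dist_mean v (fun s => dist_mean u (fun k => eta * A k s)) - c * spread u.
  rewrite -[X in _ - X](dist_mean_cst v _ x2) -mulN1r -dist_meanZ -dist_meanD.
  rewrite -[X in _ - X]mul1r -mulNr -dist_meanZ -dist_meanD.
  apply: dist_mean_le => // s; rewrite !mulN1r.
  by apply: log_gain_le => // i j; exact: hd1.
have E2 : dist_mean u (fun s => log_gain q v (fun k => eta * - A s k)) <=
    dist_mean u (fun s => dist_mean q (fun k => eta * - A s k)) -
    dist_mean u (fun s => dist_mean v (fun k => eta * - A s k)) - c * spread v.
  rewrite -[X in _ - X](dist_mean_cst u _ x1) -mulN1r -dist_meanZ -dist_meanD.
  rewrite -[X in _ - X]mul1r -mulNr -dist_meanZ -dist_meanD.
  apply: dist_mean_le => // s; rewrite !mulN1r.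
  by apply: log_gain_le => // i j; exact: hd2'.
(* By the zero-sum structure the mean payoffs of the two agents at [x] cancel. *)
have E3 : dist_mean u (fun s => dist_mean v (fun k => eta * - A s k)) =
    - dist_mean v (fun s => dist_mean u (fun k => eta * A k s)).
  rewrite dist_mean_exchange -mulN1r -dist_meanZ.
  congr dist_mean; apply/funext => s; rewrite -dist_meanZ.
  by congr dist_mean; apply/funext => k; rewrite mulrN mulN1r.
have E4 : dist_mean u (fun s => dist_mean q (fun k => eta * - A s k)) =
    - (eta * dist_mean u (fun s => dist_mean q (A s))).
  rewrite -mulNr -dist_meanZ; congr dist_mean; apply/funext => s.
  rewrite -dist_meanZ; congr dist_mean; apply/funext => k.
  by rewrite mulrN mulNr.
have E5 : dist_mean v (fun s => dist_mean p (fun k => eta * A k s)) =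
    eta * dist_mean v (fun s => dist_mean p (A ^~ s)).
  by rewrite -dist_meanZ; congr dist_mean; apply/funext => s; rewrite -dist_meanZ.
(* The equilibrium inequality is averaged over [x]; strategies outside the face carry weight 0. *)
have E6 : dist_mean v (fun s => dist_mean p (A ^~ s)) <=
    dist_mean u (fun s => dist_mean q (A s)).
  rewrite -[leLHS](dist_mean_cst u _ x1).
  apply: ler_sum => i _; have [iS|iS] := boolP (i \in S1); last first.
    by rewrite /u zx1 // !mul0r.
  apply: ler_wpM2l; first exact: x1.1.
  rewrite -[leRHS](dist_mean_cst v _ x2).
  apply: ler_sum => j _; have [jS|jS] := boolP (j \in S2); last first.
    by rewrite /v zx2 // !mul0r.
  by apply: ler_wpM2l; [exact: x2.1 | exact: hz].
have E7 := ler_wpM2l eta0 E6.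
by lra.
Qed.

(** Exponentiation turns the additive drift into a multiplicative decay. Its second-order cost is
    itself proportional to the spread, so for a small exponent the first-order gain dominates at
    every profile of the face. *)
Lemma lyapunov {R : realType} {n1 n2} (A : 'M[R]_(n1, n2))
    (eta d : R) (S1 : {set 'I_n1}) (S2 : {set 'I_n2}) (z : profile R n1 n2) :
  0 <= eta -> (forall i j, `|eta * A i j| <= 2^-1) -> 0 < d <= 1 ->
  (forall i k j, i != k -> d <= `|eta * A i j - eta * A k j|) ->
  (forall i j l, j != l -> d <= `|eta * A i j - eta * A i l|) ->
  mixedX z ->
  (forall i j, i \in S1 -> j \in S2 ->
    \sum_k z.1 ord0 k * A k j <= \sum_l z.2 ord0 l * A i l) ->
  exists (W : profile R n1 n2 -> R) (c : R), [/\ 0 < c,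
    forall x, mixedX x -> 0 <= W x <= 1 &
    forall x, face S1 S2 x -> expect A eta 1 W x + c * face_weight z x <= W x].
Proof.
move=> eta0 hA /andP[d0 d1] hd1 hd2 Xz hz.
have [p1 p2] := mixedX_dist _ Xz.
(* With this exponent the second-order cost [4 * delta ^+ 2] is [delta * (d ^+ 2 / 32)], half of the
   first-order gain; the other half is [kappa]. *)
pose delta := d ^+ 2 / 128.
have dd : 0 < d ^+ 2 by exact: exprn_gt0.
have dd1 : d ^+ 2 <= 1 by rewrite expr_le1 // ltW.
have delta0 : 0 < delta by rewrite /delta; lra.
have delta1 : delta <= 128^-1 by rewrite /delta; lra.
have kd0 : 0 < delta * (d ^+ 2 / 32) by apply: mulr_gt0 => //; lra.
pose kappa := delta * (d ^+ 2 / 32).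
have kappa0 : 0 < kappa by exact: kd0.
have kappa1 : kappa <= 8^-1.
  have : delta * (d ^+ 2 / 32) <= delta * 1 by apply: ler_wpM2l => //; lra.
  by rewrite /kappa; lra.
pose W (x : profile R n1 n2) : R :=
  geo_mean (z.1 ord0) (x.1 ord0) delta * geo_mean (z.2 ord0) (x.2 ord0) delta.
exists W, (kappa / 2); split; first by rewrite divr_gt0.
  move=> x /mixedX_dist[x1 x2]; rewrite mulr_ge0 ?geo_mean_ge0 //=.
  by apply: mulr_ile1; rewrite ?geo_mean_ge0 // geo_mean_le1 // ltW.
move=> x Fx; have [x1 x2] := mixedX_dist _ (face_sub_mixedX _ _ _ Fx).
set u := x.1 ord0 in x1; set v := x.2 ord0 in x2.
set H := spread u + spread v.
have H0 : 0 <= H by rewrite addr_ge0 ?spread_ge0.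
have H2 : H <= 2 by have := spread_le1 _ x1; have := spread_le1 _ x2; rewrite /H; lra.
pose al s := log_gain (z.1 ord0) u (fun k => eta * A k s).
pose be s := log_gain (z.2 ord0) v (fun k => eta * - A s k).
have Wstep s1 s2 : W (mwu_step A eta x s1 s2) =
    W x * (expR (delta * be s1) * expR (delta * al s2)).
  rewrite /W /mwu_step /=.
  have -> : (\row_i (x.1 ord0 i * expR (eta * A i s2) /
      \sum_k x.1 ord0 k * expR (eta * A k s2))) ord0 =
      fun i => u i * expR (eta * A i s2) / \sum_k u k * expR (eta * A k s2).
    by apply/funext => i; rewrite mxE.
  have -> : (\row_j (x.2 ord0 j * expR (eta * - A s1 j) /
      \sum_k x.2 ord0 k * expR (eta * - A s1 k))) ord0 =
      fun j => v j * expR (eta * - A s1 j) / \sum_k v k * expR (eta * - A s1 k).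
    by apply/funext => j; rewrite mxE.
  rewrite (geo_mean_step _ _ (fun i => eta * A i s2)) //.
  rewrite (geo_mean_step _ _ (fun j => eta * - A s1 j)) //.
  by rewrite -/(al s2) -/(be s1); ring.
(* The two samples are independent; the gain [al] depends only on the sample of agent 2 and [be]
   only on that of agent 1, so the expectation factors. *)
have PW : expect A eta 1 W x = W x *
    (dist_mean u (fun s => expR (delta * be s)) *
     dist_mean v (fun s => expR (delta * al s))).
  rewrite /= /dist_mean big_distrlr /= mulr_sumr; apply: eq_bigr => s1 _.
  by rewrite mulr_sumr; apply: eq_bigr => s2 _; rewrite Wstep -/u -/v; ring.
have al1 s : `|al s| <= 1 by apply: log_gain_bound.
have be1 s : `|be s| <= 1.
  by apply: log_gain_bound => // k; rewrite mulrN normrN.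
have delta4 : delta <= 4^-1 by lra.
have drift : dist_mean v al + dist_mean u be <= - (d ^+ 2 / 16 * H).
  exact: (anti_equilibrium_drift A eta d S1 S2 z x eta0 hA (ltW d0)).
have decay : dist_mean u (fun s => expR (delta * be s)) *
     dist_mean v (fun s => expR (delta * al s)) <= expR (- (kappa * H)).
  apply: (@le_trans _ _ (expR (delta * dist_mean u be + 4 * delta ^+ 2 * spread u) *
      expR (delta * dist_mean v al + 4 * delta ^+ 2 * spread v))).
    apply: ler_pM; try by apply: sumr_ge0 => i _; rewrite mulr_ge0 ?expR_ge0 ?x1.1 ?x2.1.
      exact: (dist_mean_expR_le_spread _ _ _ x1 be1 (ltW delta0) delta4).
    exact: (dist_mean_expR_le_spread _ _ _ x2 al1 (ltW delta0) delta4).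
  rewrite -expRD ler_expR.
  have := ler_wpM2l (ltW delta0) drift.
  have -> : kappa * H = delta * (d ^+ 2 / 16 * H) - 4 * delta ^+ 2 * H.
    by rewrite /kappa /delta; field.
  by rewrite /H; lra.
have Wx0 : 0 <= W x by rewrite mulr_ge0 ?geo_mean_ge0.
(* With [0 <= k <= 4^-1], [expR (- k) <= 1 - k + 2 * k ^+ 2 <= 1 - k / 2]. *)
have step : expect A eta 1 W x <= W x * (1 - kappa * H / 2).
  rewrite PW; apply: ler_wpM2l => //; apply: le_trans decay _.
  set k := kappa * H.
  have k0 : 0 <= k by rewrite mulr_ge0 // ltW.
  have k1 : k <= 4^-1.
    by have : k <= 8^-1 * 2 by [apply: ler_pM => //; exact: ltW]; lra.
  have h1 : - k <= 2^-1 by lra.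
  apply: le_trans (expR_le_quadratic _ h1) _.
  by rewrite sqrrN expr2; have : 0 <= k * (4^-1 - k) by [rewrite mulr_ge0 //; lra]; lra.
have weight : face_weight z x <= H * W x.
  apply: ler_wpM2l => //.
  have d01 : 0 <= delta <= 1 by rewrite ltW //=; lra.
  apply: ler_pM; try by apply: prodr_ge0 => i _; rewrite ?x1.1 ?x2.1.
    exact: geo_mean_ge_prod.
  exact: geo_mean_ge_prod.
have : kappa / 2 * face_weight z x <= kappa / 2 * (H * W x).
  by apply: ler_wpM2l => //; lra.
by lra.
Qed.

(** * Time averages *)

Lemma expect_le {R : realType} {n1 n2} (A : 'M[R]_(n1, n2)) (eta : R)
    (S1 : {set 'I_n1}) (S2 : {set 'I_n2}) (f g : profile R n1 n2 -> R) t :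
  (forall x, face S1 S2 x -> f x <= g x) ->
  forall x, face S1 S2 x -> expect A eta t f x <= expect A eta t g x.
Proof.
move=> fg; elim: t => [//|t IH] x Fx /=.
have [x1 x2] := mixedX_dist _ (face_sub_mixedX _ _ _ Fx).
apply: ler_sum => s1 _; apply: ler_sum => s2 _; apply: ler_wpM2l.
  by rewrite mulr_ge0 ?x1.1 ?x2.1.
by apply: IH; exact: mwu_step_face.
Qed.

Lemma expect_cst {R : realType} {n1 n2} (A : 'M[R]_(n1, n2)) (eta c : R) t x :
  mixedX x -> expect A eta t (fun=> c) x = c.
Proof.
elim: t x => [//|t IH] x Xx /=; have [[_ x1] [_ x2]] := mixedX_dist _ Xx.
transitivity (\sum_s1 \sum_s2 x.1 ord0 s1 * (x.2 ord0 s2 * c)).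
  apply: eq_bigr => s1 _; apply: eq_bigr => s2 _.
  by rewrite IH ?mulrA //; exact: mwu_step_mixedX.
under eq_bigr do rewrite -mulr_sumr -mulr_suml x2 mul1r.
by rewrite -mulr_suml x1 mul1r.
Qed.

Lemma expectD {R : realType} {n1 n2} (A : 'M[R]_(n1, n2)) (eta : R)
    (f g : profile R n1 n2 -> R) t x :
  expect A eta t (fun y => f y + g y) x =
  expect A eta t f x + expect A eta t g x.
Proof.
elim: t x => [//|t IH] x /=; rewrite -big_split /=; apply: eq_bigr => s1 _.
by rewrite -big_split /=; apply: eq_bigr => s2 _; rewrite IH mulrDr.
Qed.

Lemma expectZ {R : realType} {n1 n2} (A : 'M[R]_(n1, n2)) (eta c : R)
    (f : profile R n1 n2 -> R) t x :
  expect A eta t (fun y => c * f y) x = c * expect A eta t f x.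
Proof.
elim: t x => [//|t IH] x /=; rewrite mulr_sumr; apply: eq_bigr => s1 _.
by rewrite mulr_sumr; apply: eq_bigr => s2 _; rewrite IH mulrCA.
Qed.

Lemma expect_sum {R : realType} {n1 n2} (A : 'M[R]_(n1, n2)) (eta : R)
    {I : Type} (r : seq I) (f : I -> profile R n1 n2 -> R) t x :
  mixedX x -> expect A eta t (fun y => \sum_(i <- r) f i y) x =
  \sum_(i <- r) expect A eta t (f i) x.
Proof.
move=> Xx; elim: r => [|i r IH].
  rewrite big_nil -[RHS](expect_cst A eta 0 t x Xx).
  by congr expect; apply/funext => y; rewrite big_nil.
rewrite big_cons -IH -expectD.
by congr expect; apply/funext => y; rewrite big_cons.
Qed.

(** The Markov property (Chapman-Kolmogorov). *)
Lemma expect_expect {R : realType} {n1 n2} (A : 'M[R]_(n1, n2)) (eta : R)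
    (f : profile R n1 n2 -> R) s t x :
  expect A eta s (expect A eta t f) x = expect A eta (s + t) f x.
Proof.
elim: s x => [//|s IH] x /=; apply: eq_bigr => s1 _; apply: eq_bigr => s2 _.
by rewrite IH.
Qed.

(** The drift inequality telescopes along the chain, and [W] stays between 0 and 1. *)
Lemma sum_expect_lyapunov {R : realType} {n1 n2} (A : 'M[R]_(n1, n2)) (eta c : R)
    (S1 : {set 'I_n1}) (S2 : {set 'I_n2}) (W G : profile R n1 n2 -> R) T x :
  (forall x, mixedX x -> 0 <= W x <= 1) ->
  (forall x, face S1 S2 x -> expect A eta 1 W x + c * G x <= W x) ->
  face S1 S2 x -> c * (\sum_(t < T) expect A eta t G x) <= 1.
Proof.
move=> W01 drift Fx.
have Xx := face_sub_mixedX _ _ _ Fx.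
suff : c * (\sum_(t < T) expect A eta t G x) + expect A eta T W x <= W x.
  have : 0 <= expect A eta T W x.
    rewrite -[leLHS](expect_cst A eta 0 T x Xx).
    by apply: (expect_le A eta S1 S2) => // y /face_sub_mixedX /W01 /andP[].
  by have /andP[_] := W01 _ Xx; lra.
elim: T => [|T IH]; first by rewrite big_ord0 mulr0 add0r.
rewrite big_ord_recr /=.
have := expect_le A eta S1 S2 _ _ T drift _ Fx.
rewrite expectD expectZ expect_expect addn1.
by move: IH; rewrite mulrDr /=; lra.
Qed.

(** Each unit shift drops one term and gains another, at a cost of at most [M]. *)
Lemma sum_shift_le {R : realType} (a : nat -> R) (M : R) (k T : nat) :
  (forall t, 0 <= a t <= M) ->
  \sum_(t < T) a t <= \sum_(t < T) a (t + k)%N + k%:R * M.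
Proof.
move=> aM; elim: k => [|k IH].
  by under [X in _ <= X + _]eq_bigr do rewrite addn0; rewrite mul0r addr0.
have : \sum_(t < T) a (t + k)%N + a (T + k)%N =
    a k + \sum_(t < T) a (t + k.+1)%N.
  rewrite -(big_ord_recr T (fun t => a (t + k)%N)) big_ord_recl /= add0n.
  by congr (_ + _); apply: eq_bigr => i _; rewrite /bump add1n addSnnS.
have /andP[_ ak] := aM k; have /andP[aTk _] := aM (T + k)%N.
by rewrite -natr1 mulrDl mul1r; lra.
Qed.

Definition total_spread {R : realType} {n1 n2} (x : profile R n1 n2) : R :=
  spread (x.1 ord0) + spread (x.2 ord0).

Lemma total_spread_bound {R : realType} {n1 n2} (x : profile R n1 n2) :
  mixedX x -> 0 <= total_spread x <= 2.
Proof.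
move=> /mixedX_dist[x1 x2]; rewrite /total_spread addr_ge0 ?spread_ge0 //=.
by have := spread_le1 _ x1; have := spread_le1 _ x2; lra.
Qed.

Lemma expect_bound {R : realType} {n1 n2} (A : 'M[R]_(n1, n2)) (eta a b : R)
    (f : profile R n1 n2 -> R) t x :
  (forall x, mixedX x -> a <= f x <= b) -> mixedX x ->
  a <= expect A eta t f x <= b.
Proof.
move=> fab Xx; rewrite -(expect_cst A eta a t x Xx).
rewrite -(expect_cst A eta b t x Xx).
move: Xx; rewrite -faceT => Xx.
by apply/andP; split; apply: expect_le Xx => y; rewrite faceT => /fab /andP[].
Qed.

(** By the Markov property, averaging [f] over a window averages the time-shifted sums, and each
    shift costs at most the window length times [M], uniformly in [T]. *)
Lemma sum_expect_avg {R : realType} {n1 n2} (A : 'M[R]_(n1, n2)) (eta M : R)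
    (f : profile R n1 n2 -> R) m T x :
  (forall x, mixedX x -> 0 <= f x <= M) -> mixedX x ->
  \sum_(t < T) expect A eta t f x <=
  \sum_(t < T) expect A eta t (avg_expect A eta m.+1 f) x + m.+1%:R * M.
Proof.
move=> fM Xx.
have M0 : 0 <= M by have /andP[/le_trans h /h] := fM _ Xx.
have m0 : 0 < m.+1%:R :> R by rewrite ltr0n.
rewrite -(ler_pM2l m0) mulrDr.
have -> : m.+1%:R * \sum_(t < T) expect A eta t (avg_expect A eta m.+1 f) x =
    \sum_(k < m.+1) \sum_(t < T) expect A eta (t + k)%N f x.
  rewrite exchange_big mulr_sumr; apply: eq_bigr => t _.
  rewrite /avg_expect expectZ mulrA divff ?gt_eqF // mul1r expect_sum //.
  by apply: eq_bigr => k _; rewrite expect_expect.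
have cst_sum (y : R) : m.+1%:R * y = \sum_(k < m.+1) y.
  by rewrite sumr_const card_ord mulr_natl.
rewrite !cst_sum -big_split /=; apply: ler_sum => k _; rewrite -cst_sum.
have h := sum_shift_le (fun t => expect A eta t f x) M k T
  (fun t => expect_bound A eta 0 M f t x fM Xx).
apply: le_trans h _; rewrite lerD2l; apply: ler_wpM2r => //.
by rewrite ler_nat ltnW.
Qed.

Lemma spread_supp1 {R : realType} {n} (w : 'I_n -> R) s :
  (forall i, i != s -> w i = 0) -> spread w = 0.
Proof.
move=> ws; rewrite /spread big1 // => i _; rewrite big1 // => j _.
have [->|/ws ->] := eqVneq i s; last by rewrite !mul0r.
by have [->|/ws ->] := eqVneq j s; rewrite ?eqxx ?mulr0 ?mul0r.
Qed.

Lemma total_spread_eq0 {R : realType} {n1 n2} (x : profile R n1 n2) :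
  mixedX x -> total_spread x = 0 -> pure_profiles x.
Proof.
move=> /mixedX_dist[x1 x2] /eqP.
rewrite paddr_eq0 ?spread_ge0 // => /andP[/eqP h1 /eqP h2].
have [s1 e1] := spread_eq0 _ x1 h1; have [s2 e2] := spread_eq0 _ x2 h2.
exists s1, s2; case: x {x1 x2 h1 h2} e1 e2 => u v /= e1 e2.
by congr pair; apply/rowP => i; rewrite mxE ?e1 ?e2 eqxx.
Qed.

(** Pure profiles are absorbing: they are the faces with singleton supports, which the chain does
    not leave. *)
Lemma expect_total_spread_pure {R : realType} {n1 n2} (A : 'M[R]_(n1, n2))
    (eta : R) t x :
  pure_profiles x -> expect A eta t (@total_spread R n1 n2) x <= 0.
Proof.
move=> [s1 [s2 ->]].
have Fp := @pure_face R _ _ [set s1]%SET [set s2]%SET s1 s2 (finset.set11 _) (finset.set11 _).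
rewrite -[leRHS](expect_cst A eta 0 t _ (face_sub_mixedX _ _ _ Fp)).
apply: expect_le Fp => y [_ z1 z2]; rewrite /total_spread.
rewrite (spread_supp1 _ s1) => [|i is1]; last by rewrite z1 // finset.in_set1.
by rewrite (spread_supp1 _ s2) ?addr0 // => j js2; rewrite z2 // finset.in_set1.
Qed.

Lemma continuous_total_spread {R : realType} {n1 n2} :
  continuous (@total_spread R n1 n2).
Proof.
move=> x; apply: cvgD.
- apply: continuous_sum => i _; apply: continuous_sum => j _ y; apply: cvgMl.
  by apply: continuous_mul; exact: continuous_coord1.
- apply: continuous_sum => i _; apply: continuous_sum => j _ y; apply: cvgMl.
  by apply: continuous_mul; exact: continuous_coord2.
Qed.

Lemma continuous_face_weight {R : realType} {n1 n2} (z : profile R n1 n2) :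
  continuous (face_weight z).
Proof.
move=> x; apply: cvgM; first exact: continuous_total_spread.
apply: cvgM.
  by apply: continuous_prod => i _; exact: continuous_coord1.
by apply: continuous_prod => j _; exact: continuous_coord2.
Qed.

Lemma near_infty_div_le {R : realType} (K e : R) : 0 < e ->
  \forall T \near \oo, K / T.+1%:R <= e.
Proof.
move=> e0; have := nbhs_infty_ger (K / e); apply: filterS => T hT.
rewrite ler_pdivrMr ?ltr0n // mulrC -ler_pdivrMr //.
by apply: le_trans hT _; rewrite ler_nat.
Qed.

(* Induction on the face. For the window [m] supplied by the smaller faces,
   [avg_expect m total_spread] is small wherever [face_weight z] vanishes, hence
   by compactness it is at most [e / 2 + C * face_weight z] on the face, and the
   time sums of [face_weight z] are bounded by the Lyapunov function. *)
Lemma avg_total_spread_face {R : realType} {n1 n2} (A : 'M[R]_(n1, n2))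
    (eta d : R) :
  0 <= eta -> (forall i j, `|eta * A i j| <= 2^-1) -> 0 < d <= 1 ->
  (forall i k j, i != k -> d <= `|eta * A i j - eta * A k j|) ->
  (forall i j l, j != l -> d <= `|eta * A i j - eta * A i l|) ->
  forall (S1 : {set 'I_n1}) (S2 : {set 'I_n2}) (e : R), 0 < e ->
  \forall T \near \oo, forall x, face S1 S2 x ->
    avg_expect A eta T.+1 (@total_spread R n1 n2) x <= e.
Proof.
move=> eta0 hA d01 hd1 hd2 S1 S2.
have [N] := ubnP (#|S1| + #|S2|); elim: N S1 S2 => // N IH S1 S2.
rewrite ltnS => leN e e0.
have [[x0 Fx0]|nF] := pselect (exists x : profile R n1 n2, face S1 S2 x); last first.
  by apply: nearW => T x Fx; exfalso; apply: nF; exists x.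
have [k0 k0S] : exists k, k \in S1.
  apply/not_existsP => H.
  case: Fx0 => [[[_ h] _] z1 _]; move: h; rewrite big1.
    by move=> /eqP; rewrite eq_sym oner_eq0.
  by move=> i _; apply: z1; apply/negP/H.
have [l0 l0S] : exists l, l \in S2.
  apply/not_existsP => H.
  case: Fx0 => [[_ [_ h]] _ z2]; move: h; rewrite big1.
    by move=> /eqP; rewrite eq_sym oner_eq0.
  by move=> i _; apply: z2; apply/negP/H.
have [z Fz hz] := anti_equilibrium A S1 S2 k0 l0 k0S l0S.
have Xz := face_sub_mixedX _ _ _ Fz.
have [W [c [c0 W01 drift]]] :=
  lyapunov A eta d S1 S2 z eta0 hA d01 hd1 hd2 Xz hz.
have e4 : 0 < e / 4 by rewrite divr_gt0.
pose small S1' S2' T := forall x, face S1' S2' x ->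
  avg_expect A eta T.+1 (@total_spread R n1 n2) x <= e / 4.
have near1 : \forall T \near \oo, forall i, z.1 ord0 i != 0 -> small (S1 :\ i)%SET S2 T.
  apply: filter_forall => i; have [zi|zi] := eqVneq (z.1 ord0 i) 0.
    by apply: nearW => T /negP nz; exfalso; apply: nz; apply/eqP.
  have iS : i \in S1.
    by apply: contraNT zi => iS; apply/eqP; case: Fz => _ ->.
  have lt : (#|(S1 :\ i)%SET| + #|S2| < N)%N.
    by move: leN; rewrite (cardsD1 i S1) iS add1n addSn.
  by apply: filterS (IH _ _ lt _ e4) => T h _.
have near2 : \forall T \near \oo, forall j, z.2 ord0 j != 0 -> small S1 (S2 :\ j)%SET T.
  apply: filter_forall => j; have [zj|zj] := eqVneq (z.2 ord0 j) 0.
    by apply: nearW => T /negP nz; exfalso; apply: nz; apply/eqP.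
  have jS : j \in S2.
    by apply: contraNT zj => jS; apply/eqP; case: Fz => _ _ ->.
  have lt : (#|S1| + #|(S2 :\ j)%SET| < N)%N.
    by move: leN; rewrite (cardsD1 j S2) jS add1n addnS.
  by apply: filterS (IH _ _ lt _ e4) => T h _.
(* One window serves all the finitely many smaller faces at once. *)
have [m [hm1 hm2]] := filter_ex (filterI near1 near2).
pose f := avg_expect A eta m.+1 (@total_spread R n1 n2).
have e2 : 0 <= e / 2 by rewrite divr_ge0 // ltW.
have [||||C C0 fC] := compact_domination (face S1 S2) f (face_weight z) (e / 2)
    e2 (compact_face S1 S2).
- apply: (continuous_subspaceW (@face_sub_mixedX _ _ _ _ _)).
  apply: within_avg_expect; apply: continuous_subspaceT.
  exact: continuous_total_spread.
- by apply: continuous_subspaceT; exact: continuous_face_weight.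
- move=> x /face_sub_mixedX Xx; have [x1 x2] := mixedX_dist _ Xx.
  rewrite mulr_ge0 ?mulr_ge0 ?prodr_ge0 //; first by have /andP[] := total_spread_bound _ Xx.
    by move=> i _; rewrite x1.1.
  by move=> i _; rewrite x2.1.
(* A zero of [face_weight z] is either pure, hence absorbing, or lies on a face with one strategy
   charged by [z] removed, where the window average is at most [e / 4]. *)
- move=> x Fx /eqP; rewrite mulf_eq0 => /orP[/eqP Hx|].
    have px := total_spread_eq0 _ (face_sub_mixedX _ _ _ Fx) Hx.
    apply: (@le_lt_trans _ _ 0); last by rewrite divr_gt0.
    rewrite mulr_ge0_le0 ?invr_ge0 ?ler0n //; apply: sumr_le0 => t _.
    exact: expect_total_spread_pure.
  have e42 : e / 4 < e / 2 by lra.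
  rewrite mulf_eq0 !prodf_seq_eq0 => /orP[] /hasP[i _ /andP[zi /eqP xi]].
    apply: le_lt_trans e42; apply: (hm1 i zi); case: Fx => Xx z1 z2; split => // k.
    rewrite in_setD1 negb_and negbK => /orP[/eqP ->|/z1] //.
  apply: le_lt_trans e42; apply: (hm2 i zi); case: Fx => Xx z1 z2; split => // k.
  by rewrite in_setD1 negb_and negbK => /orP[/eqP ->|/z2].
(* The Lyapunov bound contributes [C / c] and the window shift at most [m.+1 * 2], both independent
   of [T]. *)
have := near_infty_div_le (C / c + m.+1%:R * 2) (e / 2).
rewrite divr_gt0 // => /(_ isT); apply: filterS => T hT x Fx.
have Xx := face_sub_mixedX _ _ _ Fx.
have T0 : 0 < T.+1%:R :> R by rewrite ltr0n.
rewrite /avg_expect mulrC ler_pdivrMr //.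
have h1 := sum_expect_avg A eta 2 _ m T.+1 x total_spread_bound Xx.
have h2 : \sum_(t < T.+1) expect A eta t f x <= e / 2 * T.+1%:R +
    C * \sum_(t < T.+1) expect A eta t (face_weight z) x.
  have -> : e / 2 * T.+1%:R = \sum_(t < T.+1) e / 2.
    by rewrite sumr_const card_ord mulr_natr.
  rewrite mulr_sumr -big_split /=; apply: ler_sum => t _.
  rewrite -expectZ -[X in _ <= X + _](expect_cst A eta _ t x Xx) -expectD.
  exact: (expect_le A eta S1 S2).
have h3 := sum_expect_lyapunov A eta c S1 S2 W (face_weight z) T.+1 x W01 drift Fx.
have h4 : C * \sum_(t < T.+1) expect A eta t (face_weight z) x <= C / c.
  by apply: ler_wpM2l => //; rewrite -(ler_pM2l c0) divff ?gt_eqF.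
move: hT; rewrite ler_pdivrMr // => hT.
by lra.
Qed.

(** Only the size of the payoffs limits [eta]; the gap [d] may depend on [eta], and it is positive
    as a minimum of finitely many positive numbers. *)
Lemma mwu_parameters {R : realType} {n1 n2} (A : 'M[R]_(n1, n2)) :
  injective (fun p : 'I_n1 * 'I_n2 => A p.1 p.2) ->
  exists2 eta0 : R, 0 < eta0 & forall eta, 0 < eta -> eta < eta0 ->
    (forall i j, `|eta * A i j| <= 2^-1) /\
    exists d : R, [/\ 0 < d <= 1,
      forall i k j, i != k -> d <= `|eta * A i j - eta * A k j| &
      forall i j l, j != l -> d <= `|eta * A i j - eta * A i l|].
Proof.
move=> injA; pose M := 1 + \sum_i \sum_j `|A i j|.
have AM i j : `|A i j| <= M.
  rewrite /M (bigD1 i) //= (bigD1 j) //=.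
  have h1 : 0 <= \sum_(k | k != j) `|A i k| by apply: sumr_ge0.
  have h2 : 0 <= \sum_(k | k != i) \sum_l `|A k l|.
    by apply: sumr_ge0 => k _; apply: sumr_ge0.
  by lra.
have M0 : 0 < M.
  rewrite /M ltr_pwDl //; apply: sumr_ge0 => i _; exact: sumr_ge0.
exists (2^-1 / M) => [|eta eta0]; first by rewrite divr_gt0.
rewrite ltr_pdivlMr // => etaM; split=> [i j|].
  rewrite normrM (gtr0_norm eta0); apply: le_trans (ltW etaM).
  by rewrite ler_pM2l.
pose P := [pred pp : ('I_n1 * 'I_n2) * ('I_n1 * 'I_n2) | pp.1 != pp.2].
pose g (pp : ('I_n1 * 'I_n2) * ('I_n1 * 'I_n2)) : R :=
  `|eta * A pp.1.1 pp.1.2 - eta * A pp.2.1 pp.2.2|.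
(* The initial value 1 caps [d] and covers the case where there are no two distinct entries. *)
pose d := \big[Num.min/1]_(pp | P pp) g pp.
have d_le a b : a != b -> d <= g (a, b).
  by move=> ab; exact: (bigmin_le_cond _ (j := (a, b))).
exists d; split.
- apply/andP; split; last exact: bigmin_le_id.
  apply: lt_bigmin => // -[a b] /= ab.
  rewrite /g /= normr_gt0 -mulrBr; apply: mulf_neq0; first by rewrite gt_eqF.
  rewrite subr_eq0; move: ab.
  by apply: contra => /eqP /injA /eqP.
- by move=> i k j ik; apply: (d_le (i, j) (k, j)); rewrite xpair_eqE negb_and ik.
- move=> i j l jl; apply: (d_le (i, j) (i, l)).
  by rewrite xpair_eqE negb_and jl orbT.
Qed.

(** * Time averages of continuous functions *)

Lemma avg_expect_affine {R : realType} {n1 n2} (A : 'M[R]_(n1, n2))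
    (eta a c : R) (f : profile R n1 n2 -> R) T x :
  mixedX x -> avg_expect A eta T.+1 (fun y => a + c * f y) x =
  a + c * avg_expect A eta T.+1 f x.
Proof.
move=> Xx; have T0 : T.+1%:R != 0 :> R by rewrite pnatr_eq0.
rewrite /avg_expect.
under eq_bigr do rewrite expectD expectZ (expect_cst A eta a _ x Xx).
rewrite big_split /= sumr_const card_ord -mulr_sumr -mulr_natl.
by field.
Qed.

Lemma avg_expect_cst {R : realType} {n1 n2} (A : 'M[R]_(n1, n2)) (eta c : R) T x :
  mixedX x -> avg_expect A eta T.+1 (fun=> c) x = c.
Proof.
move=> Xx; rewrite /avg_expect; under eq_bigr do rewrite expect_cst //.
by rewrite sumr_const card_ord -[c *+ _]mulr_natl mulKf // pnatr_eq0.
Qed.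

Lemma avg_expect_le {R : realType} {n1 n2} (A : 'M[R]_(n1, n2)) (eta : R)
    (f g : profile R n1 n2 -> R) T x :
  (forall x, mixedX x -> f x <= g x) -> mixedX x ->
  avg_expect A eta T f x <= avg_expect A eta T g x.
Proof.
rewrite -faceT => fg Xx; apply: ler_wpM2l; first by rewrite invr_ge0 ler0n.
by apply: ler_sum => t _; apply: expect_le Xx.
Qed.

Lemma avg_expectB {R : realType} {n1 n2} (A : 'M[R]_(n1, n2)) (eta : R)
    (f g : profile R n1 n2 -> R) T x :
  avg_expect A eta T (fun y => f y - g y) x =
  avg_expect A eta T f x - avg_expect A eta T g x.
Proof.
have -> : (fun y => f y - g y) = (fun y => f y + (-1) * g y).
  by apply/funext => y; rewrite mulN1r.
rewrite /avg_expect; under eq_bigr do rewrite expectD expectZ.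
by rewrite big_split /= -mulr_sumr mulrDr mulN1r mulrN.
Qed.

Lemma avg_expect_sum {R : realType} {n1 n2} (A : 'M[R]_(n1, n2)) (eta : R)
    {I : Type} (r : seq I) (c : I -> R) (f : I -> profile R n1 n2 -> R) T x :
  mixedX x -> avg_expect A eta T (fun y => \sum_(i <- r) c i * f i y) x =
  \sum_(i <- r) c i * avg_expect A eta T (f i) x.
Proof.
move=> Xx; rewrite /avg_expect.
under eq_bigr do rewrite expect_sum //.
rewrite exchange_big mulr_sumr /=; apply: eq_bigr => i _.
rewrite mulrCA; congr (_ * _); rewrite mulr_sumr.
by apply: eq_bigr => t _; exact: expectZ.
Qed.

(** By compactness such an [f] is at most a small constant plus a multiple of [total_spread]; the
    same holds for [- f]. *)
Lemma avg_expect_vanishing {R : realType} {n1 n2} (A : 'M[R]_(n1, n2)) (eta : R)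
    (f : profile R n1 n2 -> R) x0 :
  (forall e : R, 0 < e -> \forall T \near \oo, forall x, mixedX x ->
    avg_expect A eta T.+1 (@total_spread R n1 n2) x <= e) ->
  mixedX x0 ->
  {within @mixedX R n1 n2, continuous f} ->
  (forall x, pure_profiles x -> f x = 0) ->
  (fun T => avg_expect A eta T.+1 f x0) @ \oo --> 0.
Proof.
move=> spread_small Xx0 cf f0.
have dominated (g : profile R n1 n2 -> R) (e : R) : 0 < e ->
    {within @mixedX R n1 n2, continuous g} ->
    (forall x, pure_profiles x -> g x = 0) ->
    \forall T \near \oo, avg_expect A eta T.+1 g x0 <= e.
  move=> e0 cg g0; have e2 : 0 < e / 2 by rewrite divr_gt0.
  have [||C C0 gC] := compact_domination (@mixedX R n1 n2) g
      (@total_spread R n1 n2) (e / 2) (ltW e2) compact_mixedX cg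
      (continuous_subspaceT continuous_total_spread).
  - by move=> x /total_spread_bound /andP[].
  - by move=> x Xx /(total_spread_eq0 _ Xx) /g0 ->.
  have C1 : 0 < C + 1 by lra.
  (* The divisor is [C + 1] because [C] may be 0. *)
  have eC : 0 < e / 2 / (C + 1) by rewrite divr_gt0.
  apply: filterS (spread_small _ eC) => T hT.
  apply: le_trans (avg_expect_le A eta _ _ T.+1 x0 gC Xx0) _.
  rewrite avg_expect_affine //.
  have : C * avg_expect A eta T.+1 (@total_spread R n1 n2) x0 <=
      C * (e / 2 / (C + 1)) by apply: ler_wpM2l => //; exact: hT.
  have : C * (e / 2 / (C + 1)) <= (C + 1) * (e / 2 / (C + 1)).
    by apply: ler_wpM2r; [exact: ltW | lra].
  by rewrite [(C + 1) * _]mulrC divfK ?gt_eqF //; lra.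
apply/cvgr0Pnorm_le => e e0.
have near1 := dominated f e e0 cf f0.
have near2 : \forall T \near \oo, avg_expect A eta T.+1 (fun x => - f x) x0 <= e.
  apply: dominated => // [x|x px]; last by rewrite f0 ?oppr0.
  by apply: continuousN => ?; exact: cf.
near=> T.
have h1 : avg_expect A eta T.+1 f x0 <= e by near: T.
have h2 : avg_expect A eta T.+1 (fun x => - f x) x0 <= e by near: T.
rewrite ler_norml h1 andbT lerNl; apply: le_trans h2.
rewrite le_eqVlt; apply/orP; left; apply/eqP.
have -> : (fun x => - f x) = (fun x => 0 + (-1) * f x).
  by apply/funext => x; rewrite add0r mulN1r.
by rewrite avg_expect_affine // add0r mulN1r.
Unshelve. all: by end_near. Qed.

Definition pure_profile {R : realType} {n1 n2} (s : 'I_n1 * 'I_n2) :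
  profile R n1 n2 := (delta_mx ord0 s.1, delta_mx ord0 s.2).

Definition pure_prob {R : realType} {n1 n2} (s : 'I_n1 * 'I_n2)
  (x : profile R n1 n2) : R := x.1 ord0 s.1 * x.2 ord0 s.2.

Lemma pure_prob_pure {R : realType} {n1 n2} (s s' : 'I_n1 * 'I_n2) :
  pure_prob s (pure_profile s' : profile R n1 n2) = (s == s')%:R.
Proof.
by rewrite /pure_prob !mxE !eqxx /= -natrM mulnb -pair_eqE.
Qed.

Lemma pure_profile_mixedX {R : realType} {n1 n2} (s : 'I_n1 * 'I_n2) :
  mixedX (pure_profile s : profile R n1 n2).
Proof.
apply: (@face_sub_mixedX _ _ _ [set: _]%SET [set: _]%SET).
by apply: pure_face; rewrite finset.in_setT.
Qed.

Lemma sum_pure_prob {R : realType} {n1 n2} (x : profile R n1 n2) :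
  mixedX x -> \sum_s pure_prob s x = 1.
Proof.
move=> [[_ x1] [_ x2]].
rewrite /pure_prob -(pair_big xpredT xpredT (fun i j => x.1 ord0 i * x.2 ord0 j)) /=.
by under eq_bigr do rewrite -mulr_sumr x2 mulr1.
Qed.

(** The sum interpolates [f] at the pure profiles, since [pure_prob] is a Kronecker delta there, so
    the difference falls under [avg_expect_vanishing]. *)
Lemma avg_expect_pure_decomposition {R : realType} {n1 n2} (A : 'M[R]_(n1, n2))
    (eta : R) (f : profile R n1 n2 -> R) x0 :
  (forall e : R, 0 < e -> \forall T \near \oo, forall x, mixedX x ->
    avg_expect A eta T.+1 (@total_spread R n1 n2) x <= e) ->
  mixedX x0 ->
  {within @mixedX R n1 n2, continuous f} ->
  (fun T => avg_expect A eta T.+1 f x0 - \sum_s f (pure_profile s) *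
    avg_expect A eta T.+1 (pure_prob s) x0) @ \oo --> 0.
Proof.
move=> spread_small Xx0 cf.
under eq_cvg do rewrite -avg_expect_sum // -avg_expectB.
apply: avg_expect_vanishing => //.
  move=> x; apply: cvgB; first exact: cf.
  move: x; apply: continuous_subspaceT; apply: continuous_sum => s _ x.
  apply: cvgMr; apply: cvgM; first exact: continuous_coord1.
  exact: continuous_coord2.
move=> _ [s1 [s2 ->]]; rewrite -/(@pure_profile R n1 n2 (s1, s2)).
rewrite (bigD1 (s1, s2)) //= pure_prob_pure eqxx mulr1 big1 ?addr0 ?subrr //.
by move=> s /negbTE ss; rewrite pure_prob_pure ss mulr0.
Qed.

(** * Extraction of subsequences *)

Lemma subsequence_cvg_infty (phi : nat -> nat) :
  subsequence phi -> phi @ \oo --> \oo.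
Proof.
move=> sub; have ge k : (k <= phi k)%N.
  by elim: k => // k IH; apply: leq_ltn_trans IH (sub _ _ (ltnSn _)).
move=> B [N _ NB]; exists N => // k /= Nk; apply: NB => /=.
exact: leq_trans Nk (ge k).
Qed.

Lemma subsequence_comp (phi psi : nat -> nat) :
  subsequence phi -> subsequence psi -> subsequence (phi \o psi).
Proof. by move=> h1 h2 m n mn; apply: h1; exact: h2. Qed.

(** Subsequences are extracted one index at a time; the limits already obtained survive further
    extraction. *)
Lemma bolzano_weierstrass_family {R : realType} {I : eqType} (r : seq I)
    (u : I -> nat -> R) :
  (forall i k, 0 <= u i k <= 1) ->
  exists2 phi, subsequence phi & forall i, i \in r -> cvgn (u i \o phi).
Proof.
move=> u01; elim: r => [|i r [phi sphi IH]]; first by exists id.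
have [|psi mono_psi cpsi] := @bolzano_weierstrass R (u i \o phi).
  exists 1; split => // M M1 k _ /=.
  have /andP[h0 h1] := u01 i (phi k).
  by rewrite ger0_norm // (le_trans h1) // ltW.
have spsi : subsequence psi.
  move=> m n mn; rewrite ltnNge.
  by have -> : (psi n <= psi m)%N = (n <= m)%N := mono_psi n m; rewrite -ltnNge.
exists (phi \o psi); first exact: subsequence_comp.
move=> j; rewrite inE => /orP[/eqP -> //|/IH jr].
apply/cvg_ex; exists (limn (u j \o phi)).
exact: (cvg_comp _ _ (subsequence_cvg_infty _ spsi) jr).
Qed.

(** * Borel measurability on the space of profiles *)

Lemma measurable_mixedX {R : realType} {n1 n2} :
  measurable (@mixedX R n1 n2 : set (borelT R n1 n2)).
Proof.
rewrite -[X in measurable X]setCK; apply: measurableC.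
apply: sub_sigma_algebra; exact: (closed_openC closed_mixedX).
Qed.

Lemma measurable_within_continuous {R : realType} {n1 n2}
    (f : profile R n1 n2 -> R) :
  {within @mixedX R n1 n2, continuous f} ->
  measurable_fun (@mixedX R n1 n2 : set (borelT R n1 n2)) (f : borelT R n1 n2 -> R).
Proof.
move=> /continuousP cf.
apply: (measurability _ (RGenOpens.measurableE R)).
move=> _ [_ [a [b ->] <-]].
have /open_subspaceP[V oV VX] :
  open (f @^-1` `]a, b[%classic : set (subspace (@mixedX R n1 n2))).
  exact/cf/interval_open.
rewrite setIC -VX; apply: measurableI; last exact: measurable_mixedX.
exact: sub_sigma_algebra.
Qed.

(** * Mixtures of pure profiles *)

Lemma dirac_mem {d : measure_display} {T : measurableType d} {R : realType}
  (a : T) (U : set T) : U a -> dirac a U = 1%E :> \bar R.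
Proof. by move=> Ua; rewrite diracE mem_set. Qed.

(** Pure profiles are enumerated because [msum] takes a sequence of measures; [s0] is the default
    that [nth] asks for. *)
Definition pure_mixture {R : realType} {n1 n2} (l : 'I_n1 * 'I_n2 -> R)
    (l0 : forall s, 0 <= l s) (s0 : 'I_n1 * 'I_n2) :
    {measure set borelT R n1 n2 -> \bar R} :=
  msum (fun k => mscale (NngNum (l0 (nth s0 (index_enum _) k)))
    (dirac (pure_profile (nth s0 (index_enum _) k) : borelT R n1 n2)))
    (size (index_enum ('I_n1 * 'I_n2)%type)).

Lemma pure_mixtureE {R : realType} {n1 n2} (l : 'I_n1 * 'I_n2 -> R)
    (l0 : forall s, 0 <= l s) s0 (U : set (borelT R n1 n2)) :
  (forall s, U (pure_profile s)) ->
  pure_mixture l l0 s0 U = (\sum_s l s)%:E.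
Proof.
move=> Us; rewrite /pure_mixture /= /msum.
rewrite -sumEFin [RHS](big_nth s0) big_mkord; apply: eq_bigr => k _.
rewrite -[RHS]mule1 /mscale; congr (_ * _)%E.
by apply: dirac_mem; exact: Us.
Qed.

Lemma ge0_integral_pure_mixture {R : realType} {n1 n2} (l : 'I_n1 * 'I_n2 -> R)
    (l0 : forall s, 0 <= l s) s0 (f : profile R n1 n2 -> R) :
  measurable_fun (@mixedX R n1 n2 : set (borelT R n1 n2)) (f : borelT R n1 n2 -> R) ->
  (forall x, 0 <= f x) ->
  (\int[pure_mixture l l0 s0]_(x in (@mixedX R n1 n2 : set (borelT R n1 n2)))
    (f x)%:E = (\sum_s l s * f (pure_profile s))%:E)%E.
Proof.
move=> mf f0; have mX := @measurable_mixedX R n1 n2.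
have mf' := iffRL (measurable_EFinP _ _) mf.
rewrite ge0_integral_measure_sum //; last by move=> x _; rewrite lee_fin.
rewrite -sumEFin [RHS](big_nth s0) big_mkord; apply: eq_bigr => k _.
set a := nth s0 _ _.
rewrite ge0_integral_mscale //; last by move=> x _; rewrite lee_fin.
rewrite EFinM; congr (_ * _)%E.
transitivity (dirac (pure_profile a : borelT R n1 n2)
    (@mixedX R n1 n2 : set (borelT R n1 n2)) * (f (pure_profile a))%:E : \bar R)%E.
  exact: (integral_dirac (pure_profile a : borelT R n1 n2) mX mf').
by rewrite dirac_mem ?mul1e //; exact: pure_profile_mixedX.
Qed.

Lemma Rintegral_pure_mixture {R : realType} {n1 n2} (l : 'I_n1 * 'I_n2 -> R)
    (l0 : forall s, 0 <= l s) s0 (f : profile R n1 n2 -> R) :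
  {within @mixedX R n1 n2, continuous f} ->
  Rintegral (pure_mixture l l0 s0) (@mixedX R n1 n2 : set (borelT R n1 n2)) f =
  \sum_s l s * f (pure_profile s).
Proof.
move=> /measurable_within_continuous mf.
rewrite /Rintegral integralE -[X in (\int[_]_(x in _) (X^\+ x))%E]/(EFin \o f).
rewrite funerpos funerneg.
rewrite (ge0_integral_pure_mixture l l0 s0 f^\+) //; last exact: measurable_funrpos.
rewrite (ge0_integral_pure_mixture l l0 s0 f^\-) //; last exact: measurable_funrneg.
rewrite -EFinB /= -sumrB; apply: eq_bigr => s _.
rewrite -mulrBr; congr (_ * _); rewrite /funrpos /funrneg /=.
by rewrite !maxr_absE !subr0 !addr0 normrN; field.
Qed.

(** * Measures concentrated on the pure profiles *)

Lemma in_simplex_inhabited {R : realType} {n} (x : 'rV[R]_n) :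
  in_simplex x -> exists i : 'I_n, True.
Proof.
move=> [_ h]; apply/not_existsP => H; move: h; rewrite big1.
  by move=> /eqP; rewrite eq_sym oner_eq0.
by move=> i _; case: (H i).
Qed.

Lemma pure_profilesE {R : realType} {n1 n2} : @pure_profiles R n1 n2 =
  @mixedX R n1 n2 `&` [set x | total_spread x = 0].
Proof.
apply/seteqP; split => x [].
  move=> s1 [s2 ->]; have X := @pure_profile_mixedX R _ _ (s1, s2); split; first exact: X.
  apply/eqP; rewrite eq_le (expect_total_spread_pure (0 : 'M[R]_(n1, n2)) 0 0%N) /=;
    last by exists s1, s2.
  by have /andP[] := total_spread_bound _ X.
exact: total_spread_eq0.
Qed.

Lemma measurable_pure_profiles {R : realType} {n1 n2} :
  measurable (@pure_profiles R n1 n2 : set (borelT R n1 n2)).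
Proof.
rewrite pure_profilesE; apply: measurableI; first exact: measurable_mixedX.
rewrite -[X in measurable X]setCK; apply: measurableC.
apply: sub_sigma_algebra; apply: closed_openC.
by apply: closed_level; exact: continuous_total_spread.
Qed.

(** A nonnegative function with zero integral vanishes almost everywhere, and the zeros of
    [total_spread] in [mixedX] are the pure profiles. *)
Lemma pure_profiles_full {R : realType} {n1 n2}
    (mu : {measure set borelT R n1 n2 -> \bar R}) :
  prob_on_X mu ->
  Rintegral mu (@mixedX R n1 n2 : set (borelT R n1 n2)) (@total_spread R n1 n2) = 0 ->
  mu (@pure_profiles R n1 n2 : set (borelT R n1 n2)) = 1%E.
Proof.
move=> [muX muT] int0.
have mX := @measurable_mixedX R n1 n2.
have mP := @measurable_pure_profiles R n1 n2.
have mH : measurable_fun (@mixedX R n1 n2 : set (borelT R n1 n2))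
    (EFin \o (@total_spread R n1 n2 : borelT R n1 n2 -> R)).
  apply/measurable_EFinP; apply: measurable_within_continuous.
  by apply: continuous_subspaceT; exact: continuous_total_spread.
have H0 x : mixedX x -> 0 <= @total_spread R n1 n2 x.
  by move=> /total_spread_bound /andP[].
set I := (\int[mu]_(x in (@mixedX R n1 n2 : set (borelT R n1 n2)))
  (total_spread x)%:E)%E.
have I0 : (0 <= I)%E by apply: integral_ge0 => x /H0; rewrite lee_fin.
have I2 : (I <= 2%:E)%E.
  apply: (@le_trans _ _ (\int[mu]_(x in (@mixedX R n1 n2 : set (borelT R n1 n2)))
    (cst 2%:E x))%E).
    apply: ge0_le_integral => // x Xx; rewrite lee_fin;
      by have /andP[] := total_spread_bound _ Xx.
  by rewrite integral_cst // muX mule1.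
(* [Rintegral] would also be 0 for an infinite integral, so finiteness comes first. *)
have Ifin : I \is a fin_num.
  by rewrite ge0_fin_numE //; apply: le_lt_trans I2 _; rewrite ltry.
have Iz : I = 0%E by rewrite -(fineK Ifin); congr EFin; exact: int0.
have [N [mN muN XN]] : ae_eq mu (@mixedX R n1 n2 : set (borelT R n1 n2))
    (EFin \o (@total_spread R n1 n2 : borelT R n1 n2 -> R)) (cst 0%E).
  apply/(ae_eq_integral_abs mu mX mH); rewrite -[RHS]Iz.
  apply: eq_integral => x; rewrite inE => Xx.
  by rewrite gee0_abs // lee_fin H0.
apply/eqP; rewrite eq_le -{1}muT -muX; apply/andP; split.
  by apply: le_measure => //; rewrite inE.
apply: (@le_trans _ _ (mu ((@pure_profiles R n1 n2 : set (borelT R n1 n2)) `|` N))).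
  apply: le_measure; rewrite ?inE //; first exact: measurableU.
  move=> x Xx; have [Nx|Nx] := pselect (N x); [by right | left].
  rewrite pure_profilesE; split => //=.
  apply: contrapT => Hx; apply: Nx; apply: XN => /= H.
  by apply: Hx; have [] := H Xx.
apply: le_trans (measureU2 _ mP mN) _; rewrite -[leRHS]adde0.
by apply: leeD => //; rewrite le_eqVlt; apply/orP; left; apply/eqP; exact: muN.
Qed.

Theorem theorem5 (R : realType) (n1 n2 : nat) (A : 'M[R]_(n1, n2)) :
  injective (fun p : 'I_n1 * 'I_n2 => A p.1 p.2) ->
  exists eta0 : R, 0 < eta0 /\
    forall eta : R, 0 < eta -> eta < eta0 ->
    forall x0 : profile R n1 n2, mixedX x0 ->
      (* (1) a convergent subsequence exists *)
      (exists (phi : nat -> nat) (mu : {measure set borelT R n1 n2 -> \bar R}),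
          subsequence phi /\ prob_on_X mu /\ weak_conv_sub A eta x0 phi mu) /\
      (* (2) every convergent subsequence converges to a mixture of pure profiles *)
      (forall (phi : nat -> nat) (mu : {measure set borelT R n1 n2 -> \bar R}),
          subsequence phi -> prob_on_X mu -> weak_conv_sub A eta x0 phi mu ->
          mu (@pure_profiles R n1 n2 : set (borelT R n1 n2)) = 1%E).
Proof.
move=> /mwu_parameters[eta0 eta00 params]; exists eta0; split => //.
move=> eta eta_gt0 eta_lt x0 Xx0.
have [hA [d [d01 hd1 hd2]]] := params eta eta_gt0 eta_lt.
have spread_small (e : R) : 0 < e -> \forall T \near \oo, forall x, mixedX x ->
    avg_expect A eta T.+1 (@total_spread R n1 n2) x <= e.
  move=> e0; have := avg_total_spread_face A eta d (ltW eta_gt0) hA d01 hd1 hd2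
    [set: _]%SET [set: _]%SET e e0.
  by rewrite faceT.
split.
  have [s1 _] := in_simplex_inhabited _ Xx0.1.
  have [s2 _] := in_simplex_inhabited _ Xx0.2.
  (* By the pure decomposition, convergence of these finitely many bounded sequences decides weak
     convergence. *)
  pose u s k := avg_expect A eta k.+1 (pure_prob s) x0.
  have u01 s k : 0 <= u s k <= 1.
    have p01 x : mixedX x -> 0 <= pure_prob s x <= 1.
      move=> /mixedX_dist[x1 x2]; rewrite mulr_ge0 ?x1.1 ?x2.1 //=.
      by rewrite mulr_ile1 ?x1.1 ?x2.1 ?dist_le1.
    apply/andP; split; [rewrite -[leLHS](avg_expect_cst A eta 0 k x0 Xx0)
      | rewrite -[leRHS](avg_expect_cst A eta 1 k x0 Xx0)];
      by apply: avg_expect_le => // x /p01 /andP[].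
  have [phi sphi cphi] := bolzano_weierstrass_family (index_enum _) u u01.
  pose l s := limn (u s \o phi).
  have ul s : u s \o phi @ \oo --> l s by apply: cphi; exact: mem_index_enum.
  have l0 s : 0 <= l s.
    apply: limr_ge; first by apply: cphi; exact: mem_index_enum.
    by apply: nearW => k; have /andP[] := u01 s (phi k).
  (* No mass is lost in the limit: the functions [pure_prob s] sum to 1 on [mixedX]. *)
  have l1 : \sum_s l s = 1.
    have c1 : (fun k => \sum_s u s (phi k)) @ \oo --> \sum_s l s.
      by apply: cvg_big => // [|s _]; [exact: add_continuous | exact: ul].
    apply: (cvg_unique _ c1) => //.
    have -> : (fun k => \sum_s u s (phi k)) = (fun=> 1); last exact: cvg_cst.
    apply/funext => k; rewrite /u.
    have := avg_expect_sum A eta (index_enum _) (fun=> 1)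
      (@pure_prob R n1 n2) (phi k).+1 x0 Xx0.
    under [RHS]eq_bigr do rewrite mul1r.
    move=> <-.
    rewrite -[RHS](avg_expect_cst A eta 1 (phi k) x0 Xx0).
    apply/eqP; rewrite eq_le; apply/andP; split; apply: avg_expect_le => // x Xx;
      by under eq_bigr do rewrite mul1r; rewrite sum_pure_prob.
  exists phi, (pure_mixture l l0 (s1, s2)); split => //; split.
    split; rewrite pure_mixtureE ?l1 // => s; exact: pure_profile_mixedX.
  move=> f cf; rewrite Rintegral_pure_mixture //.
  have := avg_expect_pure_decomposition A eta f x0 spread_small Xx0 cf.
  move=> /(cvg_comp _ _ (subsequence_cvg_infty _ sphi)) c0.
  have c1 : (fun k => \sum_s f (pure_profile s) * u s (phi k)) @ \oo -->
      \sum_s f (pure_profile s) * l s.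
    apply: cvg_big => // [|s _]; first exact: add_continuous.
    by apply: cvgMr; exact: ul.
  have := cvgD c0 c1; rewrite add0r.
  rewrite (eq_bigr (fun s => l s * f (pure_profile s))) => [|s _]; last exact: mulrC.
  move=> c2; suff <- : (fun T => avg_expect A eta T.+1 f x0 -
      \sum_s f (pure_profile s) * avg_expect A eta T.+1 (pure_prob s) x0) \o phi \+
      (fun k => \sum_s f (pure_profile s) * u s (phi k)) =
      (fun k => avg_expect A eta (phi k).+1 f x0) by exact: c2.
  by apply/funext => k; rewrite /= subrK.
(* Part (2): [total_spread] serves as the test function; its time averages tend to 0, so its
   integral against [mu] is 0. *)
move=> phi mu sphi pmu conv; apply: pure_profiles_full => //.
have cH : {within @mixedX R n1 n2, continuous (@total_spread R n1 n2)}.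
  by apply: continuous_subspaceT; exact: continuous_total_spread.
apply: (cvg_unique _ (conv _ cH)) => //.
have c0 : (fun T => avg_expect A eta T.+1 (@total_spread R n1 n2) x0) @ \oo --> 0.
  apply: avg_expect_vanishing => // x.
  by rewrite pure_profilesE => -[].
exact: (cvg_comp _ _ (subsequence_cvg_infty _ sphi) c0).
Qed.
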